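(* Let $G$ be a topological group and let $X$ be a compact metric $G$-space. The following conditions are equivalent: (1) the dynamical system $(G,X)$ is hereditarily almost equicontinuous (HAE); (2) the dynamical system $(G,X)$ is Radon--Nikodým (RN), that is, it admits a proper representation on an Asplund Banach space; (3) the enveloping semigroup $E(X)$ is metrizable.
   Context: ''Compact'' means compact Hausdorff. A dynamical system $(G,X)$, or $G$-space $X$, is a compact space $X$ on which a topological group $G$ acts continuously (i.e. $G\times X\to X$ is continuous). A closed subsystem is a nonempty closed $G$-invariant subset of $X$ with the restricted action. The enveloping semigroup $E(X)=E(G,X)$ is the closure of the set of translations $\{x\mapsto gx : g\in G\}$ in the compact space $X^X$ with the product topology. Let $d$ be a compatible metric on the compact metrizable space $X$. $(G,X)$ is equicontinuous at $p\in X$ if for every $\varepsilon>0$ there is a neighborhood $O$ of $p$ such that $d(gx,gp)<\varepsilon$ for all $x\in O$ and $g\in G$ (this does not depend on the choice of $d$). $(G,X)$ is almost equicontinuous (AE) if it is equicontinuous at a dense set of points of $X$, and hereditarily almost equicontinuous (HAE) if every closed subsystem is AE. For a Banach space $V$, let $\mathrm{Iso}(V)$ be the group of all linear isometries of $V$ onto itself with the topology of pointwise convergence on $V$ (norm topology on $V$), and let $Y$ be the closed unit ball of the dual $V^*$ with the weak$^*$ topology. $\mathrm{Iso}(V)$ acts continuously on $Y$ by $(g\phi)(v)=\phi(g^{-1}v)$. A representation of $(G,X)$ on $V$ is a pair $(h,\alpha)$ where $h:G\to \mathrm{Iso}(V)$ is a continuous group homomorphism and $\alpha:X\to Y$ is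 a continuous map such that $\alpha(gx)=h(g)\alpha(x)$ for all $g\in G$, $x\in X$. The representation is proper if $\alpha$ is a topological embedding. A Banach space $V$ is Asplund if for every separable subspace $E\subset V$ the dual $E^*$ is (norm) separable. *)

(* Defs.v *)
From HB Require Import structures.
From mathcomp Require Import all_boot all_order all_algebra.
From mathcomp Require Import all_classical all_reals all_analysis.

Set Implicit Arguments.
Unset Strict Implicit.
Unset Printing Implicit Defensive.

Import Order.TTheory GRing.Theory Num.Theory.
Import numFieldNormedType.Exports.

Local Open Scope classical_set_scope.
Local Open Scope ring_scope.

Definition separable (T : topologicalType) : Prop :=
  exists2 D : set T, countable D & dense D.

Definition is_distance (R : realType) (T : Type) (d : T -> T -> R) : Prop :=
  [/\ forall x y, d x y = 0 <-> x = y,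
      forall x y, d x y = d y x
    & forall x y z, d x z <= d x y + d y z].

Definition metrizable (R : realType) (T : topologicalType) : Prop :=
  exists2 d : T -> T -> R, is_distance d &
    forall (x : T) (A : set T),
      nbhs x A <-> exists2 e : R, 0 < e & [set y | d x y < e] `<=` A.

Definition topological_embedding (S T : topologicalType) (f : S -> T) : Prop :=
  [/\ continuous f, injective f
    & forall U : set S, open U -> exists2 W : set T, open W & f @^-1` W = U].

HB.mixin Record isTopologicalGroup G & Group G & Topological G := {
  mulg_continuous : continuous (fun x : G * G => (x.1 * x.2)%g) ;
  invg_continuous : continuous (fun x : G => (x^-1)%g)
}.

#[short(type="topologicalGroupType")]
HB.structure Definition TopologicalGroup :=
  {G of Group G & Topological G & isTopologicalGroup G}.

Definition continuous_action (G : topologicalGroupType) (X : topologicalType)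
    (act : G -> X -> X) : Prop :=
  [/\ forall x, act 1%g x = x,
      forall g h x, act (g * h)%g x = act g (act h x)
    & continuous (fun gx : G * X => act gx.1 gx.2)].

Definition closed_subsystem (G : topologicalGroupType) (X : topologicalType)
    (act : G -> X -> X) (A : set X) : Prop :=
  [/\ A !=set0, closed A & forall g x, A x -> A (act g x)].

Definition enveloping_semigroup (G : topologicalGroupType)
    (X : topologicalType) (act : G -> X -> X) : set {ptws X -> X} :=
  closure ([set act g | g in [set: G]] : set {ptws X -> X}).

Section AlmostEquicontinuity.
Context (R : realType) (G : topologicalGroupType) (X : metricType R).
Variable act : G -> X -> X.

(* For an invariant [A], the two notions below are those of the restricted
   action on [A] with its subspace topology. *)
Definition equicontinuous_at (A : set X) (p : X) : Prop :=
  forall e : R, 0 < e ->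
    \forall x \near within A (nbhs p),
      forall g : G, mdist (act g x) (act g p) < e.

Definition almost_equicontinuous (A : set X) : Prop :=
  A `<=` closure [set p | A p /\ equicontinuous_at A p].

Definition hereditarily_almost_equicontinuous : Prop :=
  forall A : set X, closed_subsystem act A -> almost_equicontinuous A.

End AlmostEquicontinuity.

Section NormedDual.
Context (R : realType) (V : normedModType R).

Definition continuous_functional : {pred V -> R^o} :=
  mem [set f : V -> R^o | linear f /\ continuous f].

Lemma continuous_functionalP (f : V -> R^o) :
  reflect (linear f /\ continuous f) (f \in continuous_functional).
Proof. by apply: (iffP idP) => [/set_mem|?]; [|exact/mem_set]. Qed.

Fact continuous_functional_submod : submod_closed continuous_functional.
Proof.
split.
  apply/continuous_functionalP; split.
    by move=> a u v; rewrite -[LHS]/(0 : R^o) -[RHS]/(a *: 0 + 0 : R^o)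
      scaler0 addr0.
  by move=> x; exact: cvg_cst.
move=> a f g /continuous_functionalP[lf cf] /continuous_functionalP[lg cg].
apply/continuous_functionalP; split.
  move=> b u v.
  rewrite -[LHS]/(a *: f (b *: u + v) + g (b *: u + v)).
  rewrite -[RHS]/(b *: (a *: f u + g u) + (a *: f v + g v)) lf lg !scalerDr.
  by rewrite !scalerA [b * a]mulrC addrACA.
by move=> x; apply: cvgD; [apply: cvgZr; exact: cf|exact: cg].
Qed.

HB.instance Definition _ :=
  GRing.isSubmodClosed.Build R (V -> R^o) continuous_functional
    continuous_functional_submod.

Record normed_dual : Type := NormedDual {
  dual_fun :> V -> R^o ;
  _ : dual_fun \in continuous_functional }.

HB.instance Definition _ := [isSub for dual_fun].
HB.instance Definition _ := [Choice of normed_dual by <:].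
HB.instance Definition _ := [SubChoice_isSubLmodule of normed_dual by <:].

Definition dual_norm (f : normed_dual) : R :=
  sup [set `|f v| | v in [set v : V | `|v| <= 1]].

Lemma dual_fun_linear (f : normed_dual) : linear f.
Proof. by case: f => f /= /continuous_functionalP[]. Qed.

Lemma dual_fun_continuous (f : normed_dual) : continuous f.
Proof. by case: f => f /= /continuous_functionalP[]. Qed.

Lemma dual_fun0 (f : normed_dual) : f 0 = 0.
Proof.
by have := dual_fun_linear f (-1) 0 0; rewrite scaler0 addr0 scaleN1r addNr.
Qed.

Lemma has_sup_dual_norm (f : normed_dual) :
  has_sup [set `|f v| | v in [set v : V | `|v| <= 1]].
Proof.
split; first by exists `|f 0|, 0 => //=; rewrite normr0.
pose F : {linear V -> R^o} :=
  HB.pack (dual_fun f) (GRing.isLinear.Build _ _ _ _ (dual_fun f)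
                          (dual_fun_linear f)).
have cF : {for 0, continuous F} by exact: dual_fun_continuous.
have /linear_boundedP bF := continuous_linear_bounded 0 cF.
have [r [r0 Fr]] := pinfty_ex_gt0 bF.
exists r => _ [v /= v1 <-]; rewrite (le_trans (Fr v))//.
by rewrite ler_piMr// ltW.
Qed.

Lemma dual_norm_ge0 (f : normed_dual) : 0 <= dual_norm f.
Proof.
apply: (@le_trans _ _ `|f 0|) => //.
apply: sup_upper_bound; first exact: has_sup_dual_norm.
by exists 0 => //=; rewrite normr0.
Qed.

Lemma dual_normP (f : normed_dual) (v : V) : `|f v| <= dual_norm f * `|v|.
Proof.
have [->|v0] := eqVneq v 0; first by rewrite dual_fun0 !normr0 mulr0.
have nv : 0 < `|v| by rewrite normr_gt0.
have fZ a u : f (a *: u) = a *: f u.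
  by have := dual_fun_linear f a u 0; rewrite addr0 dual_fun0 addr0.
rewrite -ler_pdivrMr//; apply: sup_upper_bound; first exact: has_sup_dual_norm.
exists (`|v|^-1 *: v) => /=.
  by rewrite normrZ normfV normr_id mulVf// gt_eqF.
by rewrite fZ normrZ normfV normr_id mulrC.
Qed.

Lemma dual_norm_le (f : normed_dual) (r : R) :
  (forall v, `|v| <= 1 -> `|f v| <= r) -> dual_norm f <= r.
Proof.
move=> fr; apply: ge_sup; first by have [] := has_sup_dual_norm f.
by move=> _ [v /= v1 <-]; exact: fr.
Qed.

Let dual_normD (f g : normed_dual) :
  dual_norm (f + g) <= dual_norm f + dual_norm g.
Proof.
apply: dual_norm_le => v v1; rewrite (le_trans (ler_normD (f v) (g v)))//.
by apply: lerD; apply: (le_trans (dual_normP _ _)); rewrite ler_piMr//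
  dual_norm_ge0.
Qed.

Let dual_normZ_le (a : R) (f : normed_dual) :
  dual_norm (a *: f) <= `|a| * dual_norm f.
Proof.
apply: dual_norm_le => v v1; rewrite -[X in `|X|]/(a *: f v) normrZ.
rewrite ler_wpM2l//; apply: (le_trans (dual_normP _ _)).
by rewrite ler_piMr// dual_norm_ge0.
Qed.

Let dual_normZ (a : R) (f : normed_dual) :
  dual_norm (a *: f) = `|a| * dual_norm f.
Proof.
apply/eqP; rewrite eq_le dual_normZ_le/=.
have [->|a0] := eqVneq a 0; first by rewrite normr0 mul0r dual_norm_ge0.
rewrite -ler_pdivlMl ?normr_gt0// -normfV.
by rewrite -[X in dual_norm X <= _](scalerK a0) dual_normZ_le.
Qed.

Let dual_norm0_eq0 (f : normed_dual) : dual_norm f = 0 -> f = 0.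
Proof.
move=> f0; apply: val_inj; apply/funext => v /=.
by apply/eqP; rewrite -normr_le0 (le_trans (dual_normP f v))// f0 mul0r.
Qed.

HB.instance Definition _ :=
  Lmodule_isNormed.Build R normed_dual dual_normD dual_normZ dual_norm0_eq0.

(* A separate alias, because [normed_dual] itself carries the norm topology. *)
Definition weak_star : Type :=
  initial_topology (dual_fun : normed_dual -> {ptws V -> R}).

HB.instance Definition _ := Topological.on weak_star.

Definition dual_unit_ball : set weak_star :=
  [set f | `|f : normed_dual| <= 1].

End NormedDual.

(* [E : submodClosed V] is an arbitrary linear subspace of [V], not necessarily
   closed; it is given the norm induced by [V]. *)
Section Subspace.
Context (R : realType) (V : normedModType R) (E : submodClosed V).

Record linear_subspace : Type := LinearSubspace {
  subspace_val :> V ;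
  _ : subspace_val \in E }.

HB.instance Definition _ := [isSub for subspace_val].
HB.instance Definition _ := [Choice of linear_subspace by <:].
HB.instance Definition _ := [SubChoice_isSubLmodule of linear_subspace by <:].

Let subspace_norm (x : linear_subspace) : R := `|x : V|.

Let subspace_normD (x y : linear_subspace) :
  subspace_norm (x + y) <= subspace_norm x + subspace_norm y.
Proof. exact: ler_normD. Qed.

Let subspace_normZ (a : R) (x : linear_subspace) :
  subspace_norm (a *: x) = `|a| * subspace_norm x.
Proof. exact: normrZ. Qed.

Let subspace_norm0_eq0 (x : linear_subspace) : subspace_norm x = 0 -> x = 0.
Proof. by move=> /normr0_eq0 x0; exact: val_inj. Qed.

HB.instance Definition _ :=
  Lmodule_isNormed.Build R linear_subspace
    subspace_normD subspace_normZ subspace_norm0_eq0.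

End Subspace.

Definition asplund (R : realType) (V : completeNormedModType R) : Prop :=
  forall E : submodClosed V,
    separable (linear_subspace E) -> separable (normed_dual (linear_subspace E)).

Section IsometryGroup.
Context (R : realType) (V : normedModType R).

Definition linear_isometries : set {ptws V -> V} :=
  [set T | [/\ linear (T : V -> V), forall v, `|T v| = `|v|
             & forall w, exists v, T v = w]].

Definition iso : Type := set_type linear_isometries.

HB.instance Definition _ := Topological.on iso.

Definition iso_fun (T : iso) : V -> V := \val T.

Lemma isoP (T : iso) : linear_isometries (iso_fun T).
Proof. exact: set_valP. Qed.

Lemma iso_linear (T : iso) : linear (iso_fun T).
Proof. by have [] := isoP T. Qed.

Lemma iso_norm (T : iso) v : `|iso_fun T v| = `|v|.
Proof. by have [] := isoP T. Qed.

Lemma iso_surj (T : iso) w : exists v, iso_fun T v = w.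
Proof. by have [] := isoP T. Qed.

Lemma iso_inj (T : iso) : injective (iso_fun T).
Proof.
move=> v w Tvw; apply/eqP; rewrite -subr_eq0 -normr_eq0 -(iso_norm T).
have -> : v - w = -1 *: w + v by rewrite scaleN1r addrC.
by rewrite iso_linear Tvw scaleN1r addNr normr0.
Qed.

Lemma iso_ext (S T : iso) : iso_fun S =1 iso_fun T -> S = T.
Proof. by move=> ST; apply: val_inj; exact/funext. Qed.

Definition mk_iso (T : V -> V) (HT : linear_isometries T) : iso :=
  exist _ T (mem_set HT).

Fact iso_one_subproof : linear_isometries idfun.
Proof. by split=> // w; exists w. Qed.

Fact iso_mul_subproof (S T : iso) :
  linear_isometries (iso_fun S \o iso_fun T).
Proof.
split=> [a u v|v|w] /=; first by rewrite !iso_linear.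
  by rewrite !iso_norm.
have [v <-] := iso_surj S w; have [u <-] := iso_surj T v.
by exists u.
Qed.

Definition iso_inv_fun (T : iso) (w : V) : V := sval (cid (iso_surj T w)).

Lemma iso_inv_funK (T : iso) : cancel (iso_inv_fun T) (iso_fun T).
Proof. by move=> w; exact: (svalP (cid (iso_surj T w))). Qed.

Fact iso_inv_subproof (T : iso) : linear_isometries (iso_inv_fun T).
Proof.
split=> [a u v|v|w].
- by apply: (@iso_inj T); rewrite iso_linear !iso_inv_funK.
- by rewrite -(iso_norm T) iso_inv_funK.
- by exists (iso_fun T w); apply: (@iso_inj T); rewrite iso_inv_funK.
Qed.

Definition iso_one : iso := mk_iso iso_one_subproof.
Definition iso_mul (S T : iso) : iso := mk_iso (iso_mul_subproof S T).
Definition iso_inv (T : iso) : iso := mk_iso (iso_inv_subproof T).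

Fact iso_mulA : associative iso_mul.
Proof. by move=> S T U; exact: iso_ext. Qed.

Fact iso_mul1 : left_id iso_one iso_mul.
Proof. by move=> T; exact: iso_ext. Qed.

Fact iso_mulr1 : right_id iso_one iso_mul.
Proof. by move=> T; exact: iso_ext. Qed.

Fact iso_mulV : left_inverse iso_one iso_inv iso_mul.
Proof.
move=> T; apply: iso_ext => v; apply: (@iso_inj T).
exact: iso_inv_funK.
Qed.

Fact iso_mulrV : right_inverse iso_one iso_inv iso_mul.
Proof. by move=> T; apply: iso_ext => v; exact: iso_inv_funK. Qed.

HB.instance Definition _ :=
  isGroup.Build iso iso_mulA iso_mul1 iso_mulr1 iso_mulV iso_mulrV.

End IsometryGroup.

Definition representation (R : realType) (G : topologicalGroupType)
    (X : topologicalType) (act : G -> X -> X) (V : completeNormedModType R)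
    (h : G -> iso V) (alpha : X -> set_type (@dual_unit_ball R V)) : Prop :=
  [/\ continuous h,
      forall g k, h (g * k)%g = (h g * h k)%g,
      continuous alpha
    & forall g x v,
        (\val (alpha (act g x)) : normed_dual V) v =
        (\val (alpha x) : normed_dual V) (iso_fun (h g)^-1%g v)].

Definition proper_representation (R : realType) (G : topologicalGroupType)
    (X : topologicalType) (act : G -> X -> X) (V : completeNormedModType R)
    (h : G -> iso V) (alpha : X -> set_type (@dual_unit_ball R V)) : Prop :=
  representation act h alpha /\ topological_embedding alpha.

Definition radon_nikodym (R : realType) (G : topologicalGroupType)
    (X : topologicalType) (act : G -> X -> X) : Prop :=
  exists (V : completeNormedModType R) (h : G -> iso V)
    (alpha : X -> set_type (@dual_unit_ball R V)),
    asplund V /\ proper_representation act h alpha.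

(* Main.v *)
(* Let rho(x, y) = sup_g d(gx, gy). Each of the three properties is equivalent to
   the separability of (X, rho), which is phrased below by colouring X, for
   every e > 0, with countably many colours of rho-diameter at most e.

   HAE: if (X, rho) is separable, Baire's theorem in a subsystem A, applied to the
   relative boundaries of the closures of the colour classes, gives a dense set of
   equicontinuity points. Conversely, the union of all open sets that can be
   coloured is open, invariant and (Lindelof) can be coloured; an equicontinuity
   point of the complementary subsystem would enlarge it.

   Enveloping semigroup: all its elements are limits of translations, hence are
   determined by their values on a countable rho-dense set, which gives a metric.
   Conversely, if E(X) is compact metrizable then the maps p |-> px lie in the
   separable space C(E(X), X), whose uniform distance induces rho.

   RN: if X is represented in the dual of an Asplund space V, then countably many
   vectors w_j control rho (Lindelof in X * X), and the separability of the dual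
   of their span gives that of (X, rho). Conversely, let V be the space of
   continuous functions on X that are little-Hoelder of exponent 1/2 for rho; G
   acts on it by isometries, and X embeds in the unit ball of V^* as the point
   evaluations. To see that V is Asplund, let E be a subspace of V and f a
   functional on E at positive distance from the span of the evaluations at a
   countable rho-dense set. There are v_n in the unit ball of E with f(v_n) >= c
   that vanish at the first n points of this set, so v_n -> 0 pointwise on X; by
   Simons' inequality convex combinations of them tend to 0 uniformly, and then a
   gliding hump gives sums of m such elements of norm at most 2, contradicting
   f >= m c on these sums. *)
Require Import Defs.
From HB Require Import structures.
From mathcomp Require Import all_boot all_order all_algebra.
From mathcomp Require Import all_classical all_reals all_analysis.
From mathcomp Require Import lra.

Import Order.TTheory GRing.Theory Num.Theory.
Import numFieldNormedType.Exports.

Set Implicit Arguments.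
Unset Strict Implicit.
Unset Printing Implicit Defensive.

Local Open Scope classical_set_scope.
Local Open Scope ring_scope.

(** * Compactness *)

Lemma compact_finite_cover (T : topologicalType) (A : set T) (U : T -> set T) :
  compact A -> (forall x, nbhs x (U x)) ->
  exists s : seq T, forall x, A x -> exists2 y, y \in s & U y x.
Proof.
move=> cA nU.
(* The filter of finite lists directed by inclusion: a property holds eventually if it holds for
   every list extending some fixed one. *)
pose F : set_system (seq T) :=
  filter_from setT (fun s0 : seq T => [set s : seq T | {subset s0 <= s}]).
have FF : ProperFilter F.
  apply: filter_from_proper; last by move=> s _; exists s => ?.
  apply: filter_from_filter; first by exists nil.
  move=> s t _ _; exists (s ++ t) => // r /= str.
  by split=> x xs; apply: str; rewrite mem_cat xs ?orbT.
pose P (s : seq T) x := exists2 y, y \in s & U y x.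
have cov x : A x -> \forall x' \near x & s \near F, P s x'.
  move=> _; exists (U x, [set s | {subset [:: x] <= s}]).
    by split => //=; exists [:: x].
  by move=> [x' s] /= [Ux' xs]; exists x => //; apply: xs; rewrite inE.
have [s _ /(_ s)/(_ (fun _ => id)) As] :=
  (compact_near_coveringP A).1 cA _ F P _ cov.
by exists s => x /As.
Qed.

Lemma compact_nondecreasing_cover (T : topologicalType) (A : set T)
    (U : nat -> set T) :
  compact A -> (forall n, open (U n)) -> (forall n, U n `<=` U n.+1) ->
  (forall x, A x -> exists n, U n x) -> exists n, A `<=` U n.
Proof.
move=> cA oU Umon covU.
have Ule m n : (m <= n)%N -> U m `<=` U n.
  move=> /subnKC <-; elim: (n - m)%N => [|k IH]; first by rewrite addn0.
  by rewrite addnS => x /IH/Umon.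
have cov x : A x -> \forall x' \near x & n \near \oo, U n x'.
  move=> /covU[n Un]; exists (U n, [set k | n <= k]%N).
    split => /=; first by apply: open_nbhs_nbhs; split.
    by exists n.
  by move=> [x' k] /= [Ux' nk]; exact: Ule Ux'.
have [n _ /(_ n (leqnn n)) An] :=
  (compact_near_coveringP A).1 cA _ \oo U _ cov.
by exists n.
Qed.

(** Finite nets of mesh 1/(n+1) provide countably many balls; for each ball lying inside some [O i],
    one such index is kept, and [None] marks the other balls. *)
Lemma compact_lindelof (R : realType) (T : pseudoMetricType R) (K : Type)
    (O : K -> set T) :
  compact [set: T] -> (forall i, open (O i)) ->
  exists J : nat -> option K,
    forall i x, O i x -> exists n j, J n = Some j /\ O j x.
Proof.
move=> cT oO.
have /choice[net netP] : forall n, exists s : seq T, forall x, [set: T] x ->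
    exists2 y, y \in s & ball y n.+1%:R^-1 x.
  by move=> n; apply: compact_finite_cover => // x; apply: nbhsx_ballx.
have /choice[J JP] : forall p : nat * nat, exists o : option K,
    forall y, onth (net p.1) p.2 = Some y ->
      (exists i, ball y p.1.+1%:R^-1 `<=` O i) ->
    exists2 j, o = Some j & ball y p.1.+1%:R^-1 `<=` O j.
  move=> [n k] /=; case: (onth (net n) k) => [y|]; last by exists None.
  have [[i yi]|no] := pselect (exists i, ball y n.+1%:R^-1 `<=` O i).
    by exists (Some i) => _ [<-] _; exists i.
  by exists None => _ [<-].
exists (fun m => obind J (unpickle m)) => i x Oix.
have /nbhs_ballP[e /= e0 eO] : nbhs x (O i) by exact: open_nbhs_nbhs.
have [n] := @ltr_add_invr R 0 (e / 2) (divr_gt0 e0 (ltr0Sn _ _)).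
rewrite add0r => ne.
have [y ynet yx] := netP n x I.
have [j Jj yj] : exists2 j, J (n, index y (net n)) = Some j &
    ball y n.+1%:R^-1 `<=` O j.
  apply: (JP (n, _) y) => /=.
    by rewrite onthE (nth_map y) ?nth_index// index_mem ynet.
  exists i => z yz; apply: eO; rewrite (splitr e); apply: (@ball_triangle _ _ y).
    by apply: (le_ball (ltW ne)); apply: ball_sym.
  exact: (le_ball (ltW ne)).
exists (pickle (n, index y (net n))), j; rewrite pickleK /=; split => //.
exact: yj.
Qed.

(** Baire category relative to [A]: regularity yields open sets meeting [A], each with closure
    inside the previous one minus [F n], and compactness gives a cluster point of their traces on
    [A]. *)
Lemma compact_baire (T : topologicalType) (A : set T) (F : nat -> set T)
    (U : set T) :
  regular_space T -> compact A -> (forall n, closed (F n)) ->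
  (forall n V, open V -> V `&` A !=set0 -> (V `&` A) `\` F n !=set0) ->
  open U -> U `&` A !=set0 ->
  exists p, [/\ A p, U p & forall n, ~ F n p].
Proof.
move=> regT cA clF ndF oU UA.
pose good V := open V /\ V `&` A !=set0.
have /choice[next nextP] : forall p : nat * set T, exists V, good p.2 ->
    good V /\ closure V `<=` p.2 `\` F p.1.
  move=> [n V] /=.
  have [gV|] := pselect (good V); last by move=> ngV; exists V => /ngV.
  have [oV VA] := gV; have [x [[Vx Ax] Fx]] := ndF n V oV VA.
  have /regT[W nW clW] : nbhs x (V `\` F n).
    apply: open_nbhs_nbhs; split=> //; apply: openI => //.
    exact: closed_openC.
  exists W^° => _; split.
    by split; [exact: open_interior|exists x; split].
  by apply: subset_trans clW; apply: closure_subset; exact: interior_subset.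
pose V := fix V n := if n is m.+1 then next (m, V m) else U.
have gV n : good (V n) by elim: n => [//|n IH] /=; have [] := nextP (n, V n) IH.
have VS n : closure (V n.+1) `<=` V n `\` F n.
  by have [] := nextP (n, V n) (gV n).
have Vle m n : (m <= n)%N -> V n `<=` V m.
  move=> /subnKC <-; elim: (n - m)%N => [|k IH]; first by rewrite addn0.
  by rewrite addnS => x /subset_closure/VS[/IH].
pose G := filter_from setT (fun n => V n `&` A).
have FG : ProperFilter G.
  apply: filter_from_proper; last by move=> n _; have [] := gV n.
  apply: filter_from_filter; first by exists 0%N.
  move=> m n _ _; exists (maxn m n) => // x [Vx Ax].
  by split; split=> //; apply: (Vle _ (maxn m n)) => //;
    rewrite ?leq_maxl ?leq_maxr.
have GA : G A by exists 0%N => // x [].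
have [p [Ap clp]] := cA G FG GA.
have Vp n : closure (V n) p.
  move=> B Bp; have [x [[Vx _] Bx]] :=
    clp (V n `&` A) B (ex_intro2 _ _ n I (fun _ => id)) Bp.
  by exists x.
exists p; split => //; first by have [] := VS 0%N p (Vp 1%N).
by move=> n; have [] := VS n p (Vp n.+1).
Qed.

(** * Simons' inequality *)

(** The value is 0 on unbounded functions, so upper estimates by this quantity need an explicit
    bound, as in [le_snorm]. *)
Definition snorm (R : realType) (T : Type) (f : T -> R) : R :=
  sup [set `|f x| | x in [set: T]].

Section SupNorm.
Context (R : realType) (T : Type) (x0 : T).
Implicit Types f g : T -> R.

Lemma snorm_ge0 f : 0 <= snorm f.
Proof.
rewrite /snorm; set S := [set _ | _ in _].
have [hs|/sup_out-> //] := pselect (has_sup S).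
by apply: le_trans (normr_ge0 (f x0)) _; apply: sup_upper_bound => //; exists x0.
Qed.

Lemma snorm_le f b : (forall x, `|f x| <= b) -> snorm f <= b.
Proof. by move=> fb; apply: ge_sup; [exists `|f x0|, x0|move=> _ [x _ <-]]. Qed.

Lemma le_snorm f b x : (forall x, `|f x| <= b) -> `|f x| <= snorm f.
Proof.
move=> fb; apply: sup_upper_bound; last by exists x.
by split; [exists `|f x0|, x0|exists b => _ [y _ <-]].
Qed.

End SupNorm.

Section Simons.
Context (R : realType) (T : topologicalType) (C : nat -> set (T -> R)) (M m : R).
Hypothesis cT : compact [set: T].
Hypothesis contC : forall n f, C n f -> continuous f.
Hypothesis boundC : forall n f x, C n f -> `|f x| <= M.
Hypothesis C_nonempty : forall n, C n !=set0.
Hypothesis C_decr : forall n, C n.+1 `<=` C n.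
Hypothesis C_mid : forall n f g, C n f -> C n g ->
  C n (fun x => (f x + g x) / 2).
Hypothesis C_null : forall x (e : R), 0 < e ->
  exists n, forall f, C n f -> `|f x| <= e.
Hypothesis m_gt0 : 0 < m.
Hypothesis C_large : forall f, C 0%N f -> m <= snorm f.
Variable x0 : T.

(** The weight left after [k] terms: [s k] below sums the [y j], [j < k], with weights [h j.+1] of
    total [1 - h k], so [s k + h k * f] spends all the remaining weight on [f]. *)
Let h k : R := 2^-1 ^+ k.

Let h_gt0 k : 0 < h k. Proof. by rewrite exprn_gt0. Qed.

Let hS k : h k = 2 * h k.+1.
Proof. by rewrite /h exprS mulrA divff ?mul1r ?pnatr_eq0. Qed.

Let M_ge0 : 0 <= M.
Proof. by have [f Cf] := C_nonempty 0; rewrite (le_trans _ (boundC x0 Cf)). Qed.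

Let h_small (e : R) n : 0 < e -> exists2 k, (n <= k)%N & M * h k <= e.
Proof.
move=> e0; have [k Mk] : exists k, M / e <= k%:R.
  exists (Num.truncn (M / e)).+1; apply: ltW.
  by case/andP: (truncn_itv (divr_ge0 M_ge0 (ltW e0))).
exists (n + k)%N; first exact: leq_addr.
have kh : k%:R <= (2 : R) ^+ (n + k).
  by rewrite -natrX ler_nat
    (leq_trans (ltnW (ltn_expl k (ltnSn 1))))// leq_exp2l// leq_addl.
rewrite /h exprVn ler_pdivrMr ?exprn_gt0// mulrC.
by rewrite -ler_pdivrMr// (le_trans Mk).
Qed.

(** Exactly the loss that lets the slope pass from [m * (2^-1 + h k.+1)] to [m * (2^-1 + h k.+2)] in
    the induction below; it starts at [m] and stays above [m / 2]. *)
Let eps k := m * h k.+1 * h k.+2.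

(** Near-minimisers are chosen at once for every stage and every partial sum, so that the sequence
    itself is an ordinary recursion. *)
Let choose_next : exists Y : nat * (T -> R) -> T -> R, forall p,
  C p.1 (Y p) /\ forall f, C p.1 f ->
    snorm (fun x => p.2 x + h p.1 * Y p x) <=
    snorm (fun x => p.2 x + h p.1 * f x) + eps p.1.
Proof.
suff /choice[Y YP] : forall p : nat * (T -> R), exists y, C p.1 y /\ forall f,
    C p.1 f -> snorm (fun x => p.2 x + h p.1 * y x) <=
      snorm (fun x => p.2 x + h p.1 * f x) + eps p.1 by exists Y.
move=> [k s] /=.
pose S := [set snorm (fun x => s x + h k * f x) | f in C k].
have S0 : lbound S 0.
  by move=> _ [f _ <-]; exact: snorm_ge0 x0 _.
have infS : has_inf S.
  split; last by exists 0.
  by have [f Cf] := C_nonempty k; exists (snorm (fun x => s x + h k * f x)), f.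
have e0 : 0 < eps k by apply: mulr_gt0 => //; apply: mulr_gt0.
have [_ [f Cf <-] fS] := inf_adherent e0 infS.
exists f; split => // g Cg; apply: (le_trans (ltW fS)); rewrite lerD2r.
by apply: ge_inf; [exists 0|exists g].
Qed.

Let Y := sval (cid choose_next).
Let YP := svalP (cid choose_next).

Let s := fix s k : T -> R :=
  if k is j.+1 then fun x => s j x + h j.+1 * Y (j, s j) x else fun=> 0.
Let y k := Y (k, s k).

Let sS k x : s k.+1 x = s k x + h k.+1 * y k x. Proof. by []. Qed.

Let Cy k : C k (y k). Proof. by have [] := YP (k, s k). Qed.

Let ymin k f : C k f -> snorm (fun x => s k x + h k * y k x) <=
  snorm (fun x => s k x + h k * f x) + eps k.
Proof. by have [_] := YP (k, s k); apply. Qed.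

Let C_le j k : (j <= k)%N -> C k `<=` C j.
Proof.
move=> /subnKC <-; elim: (k - j)%N => [|i IH]; first by rewrite addn0.
by rewrite addnS => f /C_decr/IH.
Qed.

Let tail k j x d : (forall n, (k <= n)%N -> `|y n x| <= d) ->
  `|s (k + j) x - s k x| <= d * (h k - h (k + j)).
Proof.
move=> yd; elim: j => [|j IH]; first by rewrite addn0 !subrr mulr0 normr0.
rewrite addnS sS; have := yd (k + j)%N (leq_addr _ _); move: IH.
have := hS (k + j); have := h_gt0 (k + j).+1.
rewrite !ler_norml => h0 -> /andP[a1 a2] /andP[b1 b2].
apply/andP; split; nra.
Qed.

Let tailM k j x : `|s (k + j) x - s k x| <= M * (h k - h (k + j)).
Proof. by apply: tail => n _; exact: boundC (Cy n). Qed.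

Let s_bound k x : `|s k x| <= M.
Proof.
have := tailM 0 k x; rewrite add0n subr0 => /le_trans; apply.
have := h_gt0 k; rewrite /h expr0; have := M_ge0; nra.
Qed.

Let sf_bound k f x : C k f -> `|s k x + h k * f x| <= M + h k * M.
Proof.
move=> Cf; rewrite (le_trans (ler_normD _ _))// lerD//.
by rewrite normrM gtr0_norm// ler_pM2l//; exact: boundC Cf.
Qed.

(** Since [h i = 2 * h i.+1], the last term and [f] merge into their midpoint with weight [h i];
    repeating this folds all terms from index [k] on into one element of [C k]. *)
Let pull_back k j f : C (k + j)%N f -> exists2 g, C k g &
  forall x, s (k + j) x + h (k + j) * f x = s k x + h k * g x.
Proof.
elim: j f => [|j IH] f; first by rewrite addn0 => Cf; exists f.
rewrite addnS => Cf.
have [|g Cg gE] := IH (fun x => (y (k + j) x + f x) / 2).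
  by apply: C_mid; [exact: Cy|exact: C_decr].
by exists g => // x; rewrite -gE sS (hS (k + j)); lra.
Qed.

(* Each step loses at most a summable part of the slope [m]. *)
Let slope k f : C k f ->
  snorm (s k) + h k * (m * (2^-1 + h k.+1)) <=
  snorm (fun x => s k x + h k * f x).
Proof.
elim: k f => [|k IH] f Cf.
  have -> : snorm (s 0) = 0.
    apply/eqP; rewrite eq_le; apply/andP; split.
      by apply: (snorm_le x0) => x; rewrite normr0.
    exact: snorm_ge0 x0 _.
  have -> : (fun x => s 0 x + h 0 * f x) = f.
    by apply/funext => x; rewrite /= add0r mul1r.
  by rewrite add0r mul1r /h expr1 -div1r -splitr mulr1 C_large.
have IHy := IH _ (Cy k).
(* The midpoint of [y k] and [f] lies in [C k] and competes with the near-minimiser [y k]. *)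
have mid : snorm (fun x => s k x + h k * y k x) <=
    snorm (fun x => s k.+1 x + h k.+1 * f x) + eps k.
  have := ymin (C_mid (Cy k) (C_decr Cf)); congr (_ <= snorm _ + _).
  by apply/funext => x; rewrite sS (hS k); lra.
have conv : snorm (s k.+1) <=
    (snorm (s k) + snorm (fun x => s k x + h k * y k x)) / 2.
  apply: (snorm_le x0) => x.
  have -> : s k.+1 x = (s k x + (s k x + h k * y k x)) / 2.
    by rewrite sS (hS k); lra.
  rewrite normrM (ger0_norm (_ : 0 <= 2^-1)) ?invr_ge0// ler_pM2r ?invr_gt0//.
  rewrite (le_trans (ler_normD _ _))// lerD//.
    exact: (le_snorm x0 _ (s_bound k)).
  exact: (le_snorm x0 _ (fun x => sf_bound x (Cy k))).
move: mid conv IHy; rewrite /eps (hS k) (hS k.+1).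
by have := h_gt0 k.+2; have := m_gt0; nra.
Qed.

(** The limit of [s k], written as a cut: every [s i - M * h i] lies below every [s j + M * h j],
    which gives the rate of convergence directly. *)
Let z x := sup [set s k x - M * h k | k in [set: nat]].

Let s_sep i j x : s i x - M * h i <= s j x + M * h j.
Proof.
have [ij|/ltnW ji] := leqP i j.
  have := tailM i (j - i) x; rewrite subnKC// ler_norml => /andP[a b].
  have := h_gt0 j; have := h_gt0 i; have := M_ge0; nra.
have := tailM j (i - j) x; rewrite subnKC// ler_norml => /andP[a b].
have := h_gt0 j; have := h_gt0 i; have := M_ge0; nra.
Qed.

Let zs k x : `|z x - s k x| <= M * h k.
Proof.
have zub : ubound [set s k x - M * h k | k in [set: nat]] (s k x + M * h k).
  by move=> _ [i _ <-]; exact: s_sep.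
have z1 : z x <= s k x + M * h k.
  by apply: ge_sup => //; exists (s 0 x - M * h 0), 0%N.
have z2 : s k x - M * h k <= z x.
  apply: sup_upper_bound; last by exists k.
  by split; [exists (s 0 x - M * h 0), 0%N|exists (s k x + M * h k)].
by rewrite ler_norml; lra.
Qed.

Let s_cont k : continuous (s k).
Proof.
elim: k => [|k IH] x; first exact: cvg_cst.
apply: cvgD; first exact: IH.
by apply: cvgMr; exact: (contC (Cy k)).
Qed.

Let z_cont : continuous z.
Proof.
move=> x; apply/cvgrPdist_le => e e0.
have [k _ Mh] := h_small 0 (divr_gt0 e0 (ltr0Sn R 2)).
have /cvgrPdist_le/(_ (e / 3) (divr_gt0 e0 (ltr0Sn R 2))) := @s_cont k x.
apply: filterS => t st.
have -> : z x - z t = (z x - s k x) + (s k x - s k t) - (z t - s k t) by lra.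
rewrite (le_trans (ler_normB _ _))//.
rewrite (le_trans (lerD (ler_normD _ _) (lexx _)))//.
have := zs k x; have := zs k t; lra.
Qed.

Lemma simons_contradiction : False.
Proof.
have [x _ xmax] : exists2 x, x \in [set: T] &
    forall t, t \in [set: T] -> `|z t| <= `|z x|.
  apply: compact_EVT_max => //; first by exists x0.
  apply: continuous_subspaceT => t; apply: (@cvg_norm _ _ _ _ _ z).
  exact: z_cont.
(* For large [j] the function [s j + h j * y j] is uniformly close to [z]; [pull_back] rewrites it
   as [s k + h k * g], to which [slope] applies. *)
have steep k : `|s k x| + h k * (m / 2) <= `|z x|.
  apply/ler_addgt0Pl => e e0.
  have [j kj Mh] := h_small k (divr_gt0 e0 (ltr0Sn R 1)).
  have [|g Cg gE] := @pull_back k (j - k) (y j); first by rewrite subnKC.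
  have : snorm (fun x => s j x + h j * y j x) <= M * h j + `|z x| + h j * M.
    apply: (snorm_le x0) => t.
    rewrite (le_trans (ler_normD _ _))// lerD//; last first.
      by rewrite normrM gtr0_norm// ler_pM2l//; exact: boundC (Cy j).
    rewrite -[X in `|X|](subrK (z t)) (le_trans (ler_normD _ _))// lerD//.
      by rewrite distrC zs.
    by apply: xmax; rewrite inE.
  have -> : (fun x => s j x + h j * y j x) = (fun x => s k x + h k * g x).
    by apply/funext => t; rewrite -gE subnKC.
  have := slope Cg; have := le_snorm x0 x (s_bound k).
  have : 0 <= h k * (m * h k.+1) by rewrite !mulr_ge0// ltW.
  by rewrite mulrDr mulrDr; move: Mh; rewrite (mulrC M); lra.
(* From stage [N] on each [y n] is at most [m / 4] at [x], so [z] gains at most half of what [steep]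
   demands. *)
have [N yN] := C_null x (divr_gt0 m_gt0 (ltr0Sn R 3)).
have zN : `|z x - s N x| <= h N * (m / 4).
  apply/ler_addgt0Pl => e e0.
  have [j Nj Mh] := h_small N e0.
  have := @tail N (j - N) x (m / 4); rewrite subnKC// => tl.
  have {}tl : `|s j x - s N x| <= m / 4 * (h N - h j).
    by apply: tl => n Nn; apply: yN; apply: (C_le Nn); exact: Cy.
  have -> : z x - s N x = (z x - s j x) + (s j x - s N x) by lra.
  rewrite (le_trans (ler_normD _ _))//.
  by have := zs j x; have := h_gt0 j; have := m_gt0; nra.
have := steep N; have := lerB_dist (z x) (s N x).
have := h_gt0 N; have := m_gt0; nra.
Qed.

End Simons.

(* Simons' argument: if every element of [C 0] had sup norm larger than [m], one
   could choose the [y_k] in [C k] so that the sup norm of the partial sums of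
   [z = \sum_k y_k / 2 ^ k.+1] grows with slope at least [m / 2] all the way up
   to [z]; a point where [|z|] is maximal would then see infinitely many [y_k]
   not close to [0]. *)
Lemma simons_null (R : realType) (T : topologicalType)
    (C : nat -> set (T -> R)) (M : R) :
  compact [set: T] ->
  (forall n f, C n f -> continuous f) ->
  (forall n f x, C n f -> `|f x| <= M) ->
  (forall n, C n !=set0) -> (forall n, C n.+1 `<=` C n) ->
  (forall n f g, C n f -> C n g -> C n (fun x => (f x + g x) / 2)) ->
  (forall x e, 0 < e -> exists n, forall f, C n f -> `|f x| <= e) ->
  forall m, 0 < m -> exists2 f, C 0%N f & forall x, `|f x| <= m.
Proof.
move=> cT contC boundC C_nonempty C_decr C_mid C_null m m0.
have [[x0]|T0] := pselect (exists x : T, True); last first.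
  by have [f Cf] := C_nonempty 0%N; exists f => // x; case: T0; exists x.
move=> _; apply: contrapT => no.
apply: (simons_contradiction cT contC boundC C_nonempty C_decr C_mid
  C_null m0) => // f Cf.
rewrite leNgt; apply/negP => fm; apply: no; exists f => // x.
by apply: le_trans (ltW fm); apply: (le_snorm x0) => y; exact: boundC Cf.
Qed.

(** * Little-Lipschitz functions *)

Section LittleLipschitz.
Context (R : realType) (T : topologicalType) (w : T -> T -> {nonneg R}).

(** One constant for both estimates: the least one is the maximum of the sup norm and the Lipschitz
    constant for [w], which need not be a distance. *)
Definition lip_bound (f : T -> R) (M : R) : Prop :=
  (forall x, `|f x| <= M) /\ forall x y, `|f x - f y| <= M * (w x y)%:num.

Definition little_at_diagonal (f : T -> R) : Prop := forall e : R, 0 < e ->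
  exists2 t : R, 0 < t & forall x y, (w x y)%:num < t -> `|f x - f y| <= e * (w x y)%:num.

Definition little_lipschitz : {pred T -> R^o} := mem [set f : T -> R^o |
  [/\ continuous f, exists M, lip_bound f M & little_at_diagonal f]].

Lemma little_lipschitzP (f : T -> R^o) :
  reflect [/\ continuous f, exists M, lip_bound f M & little_at_diagonal f]
          (f \in little_lipschitz).
Proof. by apply: (iffP idP) => [/set_mem|?]; [|exact/mem_set]. Qed.

Lemma lip_boundD f g M N : lip_bound f M -> lip_bound g N ->
  lip_bound (fun x => f x + g x) (M + N).
Proof.
move=> [fM fwM] [gN gwN]; split=> [x|x y].
  by rewrite (le_trans (ler_normD _ _))// lerD.
rewrite opprD addrACA (le_trans (ler_normD _ _))// mulrDl lerD//.
Qed.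

Lemma lip_boundZ a f M : lip_bound f M -> lip_bound (fun x => a * f x) (`|a| * M).
Proof.
move=> [fM fwM]; split=> [x|x y]; first by rewrite normrM ler_wpM2l.
by rewrite -mulrBr normrM -mulrA ler_wpM2l.
Qed.

Fact little_lipschitz_submod : submod_closed little_lipschitz.
Proof.
split.
  apply/little_lipschitzP; split; first by move=> x; exact: cvg_cst.
    by exists 0; split=> [x|x y]; rewrite ?subr0 normr0 ?mul0r.
  by move=> e e0; exists e => // x y _; rewrite subr0 normr0 mulr_ge0// ltW.
move=> a f g /little_lipschitzP[cf [M fM] lf] /little_lipschitzP[cg [N gN] lg].
apply/little_lipschitzP; split.
- by move=> x; apply: cvgD; [apply: cvgZr; exact: cf|exact: cg].
- by exists (`|a| * M + N); apply: lip_boundD => //; exact: lip_boundZ.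
move=> e e0.
have [s s0 fs] := lf (e / 2 / (`|a| + 1)) (divr_gt0 (divr_gt0 e0 (ltr0Sn _ _))
  (ltr_wpDl (normr_ge0 a) ltr01)).
have [t t0 gt] := lg (e / 2) (divr_gt0 e0 (ltr0Sn _ _)).
exists (Num.min s t) => [|x y]; first by rewrite lt_min s0.
rewrite lt_min => /andP[/fs fxy /gt gxy].
have -> : (a *: f + g) x - (a *: f + g) y = a * (f x - f y) + (g x - g y).
  by rewrite mulrBr -[X in X - _]/(a * f x + g x) -[X in _ - X]/(a * f y + g y)
    opprD addrACA.
rewrite (le_trans (ler_normD _ _))// (splitr e) mulrDl lerD// normrM.
have a1 : 0 < `|a| + 1 by apply: ltr_wpDl.
apply: (@le_trans _ _ ((`|a| + 1) * `|f x - f y|)).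
  by rewrite ler_wpM2r// lerDl.
by rewrite mulrC -ler_pdivlMr// mulrAC.
Qed.

HB.instance Definition _ := GRing.isSubmodClosed.Build R (T -> R^o)
  little_lipschitz little_lipschitz_submod.

Record little_lip : Type := LittleLip {
  little_lip_fun :> T -> R^o ;
  _ : little_lip_fun \in little_lipschitz }.

HB.instance Definition _ := [isSub for little_lip_fun].
HB.instance Definition _ := [Choice of little_lip by <:].
HB.instance Definition _ := [SubChoice_isSubLmodule of little_lip by <:].

Lemma little_lip_continuous (f : little_lip) : continuous f.
Proof. by case: f => f /= /little_lipschitzP[]. Qed.

Lemma little_lip_little (f : little_lip) : little_at_diagonal f.
Proof. by case: f => f /= /little_lipschitzP[]. Qed.

(** The condition [0 <= M] keeps the set bounded below when [T] is empty. *)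
Definition lip_norm (f : little_lip) : R :=
  inf [set M | 0 <= M /\ lip_bound f M].

Lemma has_inf_lip_norm (f : little_lip) :
  has_inf [set M | 0 <= M /\ lip_bound f M].
Proof.
split; last by exists 0 => M [].
case: f => f /= /little_lipschitzP[_ [M [fM fwM]] _].
have [[x]|T0] := pselect (exists x : T, True).
  by exists M; split => //; rewrite (le_trans _ (fM x)).
by exists 0; split => //; split=> x; case: T0; exists x.
Qed.

Lemma lip_norm_ge0 (f : little_lip) : 0 <= lip_norm f.
Proof.
apply: lb_le_inf; first by have [] := has_inf_lip_norm f.
by move=> M [].
Qed.

Lemma lip_norm_le (f : little_lip) M : 0 <= M -> lip_bound f M -> lip_norm f <= M.
Proof. by move=> M0 fM; apply: ge_inf => //; exists 0 => N []. Qed.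

Lemma lip_normP (f : little_lip) : lip_bound f (lip_norm f).
Proof.
have near e : 0 < e -> exists M,
    [/\ lip_bound f M, lip_norm f <= M & M < lip_norm f + e].
  move=> e0; have [M [M0 fM] Me] := inf_adherent e0 (has_inf_lip_norm f).
  by exists M; split => //; exact: lip_norm_le.
split=> [x|x y].
  apply/ler_addgt0Pr => e /near[M [[fM _] _ Me]].
  by rewrite (le_trans (fM x))// ltW.
apply/ler_addgt0Pr => e e0.
have w1 : 0 < (w x y)%:num + 1 by apply: ltr_wpDl.
have [M [[_ fM] le_M Me]] := near (e / ((w x y)%:num + 1)) (divr_gt0 e0 w1).
rewrite (le_trans (fM x y))// -lerBlDl -mulrBl.
apply: (@le_trans _ _ ((M - lip_norm f) * ((w x y)%:num + 1))).
  by rewrite ler_wpM2l ?subr_ge0// lerDl.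
by rewrite -ler_pdivlMr// lerBlDl ltW.
Qed.

Let lip_normD (f g : little_lip) : lip_norm (f + g) <= lip_norm f + lip_norm g.
Proof.
apply: lip_norm_le; first by rewrite addr_ge0 ?lip_norm_ge0.
by apply: lip_boundD; exact: lip_normP.
Qed.

Let lip_normZ_le (a : R) (f : little_lip) : lip_norm (a *: f) <= `|a| * lip_norm f.
Proof.
apply: lip_norm_le; first by rewrite mulr_ge0 ?lip_norm_ge0.
by apply: lip_boundZ; exact: lip_normP.
Qed.

Let lip_normZ (a : R) (f : little_lip) : lip_norm (a *: f) = `|a| * lip_norm f.
Proof.
apply/eqP; rewrite eq_le lip_normZ_le/=.
have [->|a0] := eqVneq a 0; first by rewrite normr0 mul0r lip_norm_ge0.
rewrite -ler_pdivlMl ?normr_gt0// -normfV.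
by rewrite -[X in lip_norm X <= _](scalerK a0) lip_normZ_le.
Qed.

Let lip_norm0_eq0 (f : little_lip) : lip_norm f = 0 -> f = 0.
Proof.
move=> f0; apply: val_inj; apply/funext => x /=.
by apply/eqP; rewrite -normr_le0 -f0; have [->] := lip_normP f.
Qed.

HB.instance Definition _ :=
  Lmodule_isNormed.Build R little_lip lip_normD lip_normZ lip_norm0_eq0.

Lemma little_lip_normP (f : little_lip) : lip_bound f `|f|.
Proof. exact: lip_normP. Qed.

Lemma little_lip_norm_le (f : little_lip) (M : R) :
  0 <= M -> lip_bound f M -> `|f| <= M.
Proof. exact: lip_norm_le. Qed.

Lemma little_lip_funD (f g : little_lip) x : (f + g) x = f x + g x :> R.
Proof. by []. Qed.

Lemma little_lip_funZ a (f : little_lip) x : (a *: f) x = a * f x :> R.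
Proof. by []. Qed.

Lemma ler_little_lip (f : little_lip) x : `|f x| <= `|f|.
Proof. by have [] := little_lip_normP f. Qed.

Let little_lip_complete (F : set_system little_lip) :
  ProperFilter F -> cauchy F -> cvg F.
Proof.
move=> FF cF.
have near e : 0 < e -> exists u : little_lip, \forall v \near F, `|u - v| < e.
  move=> e0; have [u Fu] := (cauchyP F).1 cF e e0; exists u.
  by move: Fu; rewrite -ball_normE.
have cvgF x : cvg ((fun v : little_lip => v x) @ F).
  apply: cauchy_cvg; apply: cauchy_exP => e /near[u Fu].
  exists (u x); apply: (@filterS _ F) Fu => v uv; rewrite -ball_normE /=.
  exact: le_lt_trans (ler_little_lip (u - v) x) uv.
pose f x := lim ((fun v : little_lip => v x) @ F).
(* Norm estimates involve at most two points at a time, so they survive the pointwise limit; each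
   property of [f] is then inherited from a nearby [u]. *)
have bound u e : (\forall v \near F, `|u - v| < e) ->
    lip_bound (fun x => u x - f x) e.
  move=> Fu.
  have close x d : 0 < d -> \forall v \near F, `|f x - (v : little_lip) x| <= d.
    by move=> d0; have /cvgrPdist_le := cvgF x; apply.
  split=> [x|x y]; apply/ler_addgt0Pr => d d0.
    have [v [uv fv]] := filter_ex (filterI Fu (close x d d0)).
    have -> : u x - f x = (u - v) x - (f x - v x) by rewrite opprB addrA subrK.
    rewrite (le_trans (ler_normB _ _))// lerD//.
    by rewrite (le_trans (ler_little_lip _ _))// ltW.
  have d2 : 0 < d / 2 by rewrite divr_gt0.
  have [v [[uv fv] gv]] :=
    filter_ex (filterI (filterI Fu (close x _ d2)) (close y _ d2)).
  have -> : u x - f x - (u y - f y) =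
      ((u - v) x - (u - v) y) - ((f x - v x) - (f y - v y)).
    rewrite -[(u - v) x]/(u x - v x) -[(u - v) y]/(u y - v y); lra.
  rewrite (le_trans (ler_normB _ _))// lerD//.
    apply: le_trans ((little_lip_normP (u - v)).2 x y) _.
    by rewrite ler_wpM2r// ltW.
  by rewrite (le_trans (ler_normB _ _))// (splitr d) lerD.
have fP : (f : T -> R^o) \in little_lipschitz.
  apply/little_lipschitzP; split.
  - move=> x; apply/cvgrPdist_le => e e0.
    have [u /bound[uf _]] := near (e / 3) (divr_gt0 e0 (ltr0Sn R 2)).
    have /cvgrPdist_le/(_ (e / 3) (divr_gt0 e0 (ltr0Sn R 2))) :=
      @little_lip_continuous u x.
    apply: filterS => t ut.
    have -> : f x - f t = (u t - f t) + ((u x : R) - u t) - (u x - f x) by lra.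
    rewrite (le_trans (ler_normB _ _))//.
    rewrite (le_trans (lerD (ler_normD _ _) (lexx _)))//.
    have := uf x; have := uf t; lra.
  - have [u /bound uf] := near 1 ltr01.
    exists (`|-1| * 1 + `|u|).
    have := lip_boundD (lip_boundZ (-1) uf) (little_lip_normP u).
    by congr (lip_bound _ _); apply/funext => x; lra.
  - move=> e e0; have e2 : 0 < e / 2 by rewrite divr_gt0.
    have [u /bound[_ uf]] := near _ e2.
    have [t t0 ut] := little_lip_little u e2.
    exists t => // x y /ut uxy.
    have -> : f x - f y = (u x - u y) - (u x - f x - (u y - f y)) by lra.
    rewrite (le_trans (ler_normB _ _))// (splitr e) mulrDl lerD//.
apply/cvg_ex; exists (LittleLip fP); apply/cvgrPdist_le => e e0.
have e2 : 0 < e / 2 by rewrite divr_gt0.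
have [u Fu] := near _ e2; have uf := bound _ _ Fu.
have {}uf : `|u - LittleLip fP| <= e / 2.
  by apply: little_lip_norm_le => //; exact: ltW.
apply: filterS Fu => v uv.
have -> : LittleLip fP - v = (u - v) - (u - LittleLip fP).
  by rewrite opprB [RHS]addrC addrA subrK.
by rewrite (le_trans (ler_normB _ _))// (splitr e) lerD// ltW.
Qed.

HB.instance Definition _ :=
  Uniform_isComplete.Build little_lip little_lip_complete.

End LittleLipschitz.

(** * Separable duals *)

Section RationalSpan.
Context (R : realType) (V : normedModType R) (w : nat -> V).

Fixpoint rat_span (n : nat) : set V :=
  if n is m.+1 then
    [set p.1 + ratr p.2 *: w m | p in rat_span m `*` [set: rat]]
  else [set 0].

Lemma countable_rat_span n : countable (rat_span n).
Proof.
elim: n => [|n IH]; first exact: countable1.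
by apply: (sub_countable (card_image_le _ _)); exact: countableX.
Qed.

Lemma rat_span_approx n (a : nat -> R) (e : R) : 0 < e ->
  exists2 u, rat_span n u & `|\sum_(j < n) a j *: w j - u| < e.
Proof.
elim: n e => [|n IH] e e0.
  by exists 0 => //; rewrite big_ord0 subrr normr0.
have e2 : 0 < e / 2 by rewrite divr_gt0.
have [u nu au] := IH _ e2.
have w1 : 0 < `|w n| + 1 by apply: ltr_wpDl.
have [q] := @rat_in_itvoo R (a n) (a n + e / 2 / (`|w n| + 1))
  (ltr_pwDr (divr_gt0 e2 w1) (lexx _)).
rewrite in_itv /= => /andP[q1 q2].
exists (u + ratr q *: w n); first by exists (u, q).
rewrite big_ord_recr /= opprD addrACA -scalerBl.
rewrite (le_lt_trans (ler_normD _ _))// (splitr e) ltr_leD// normrZ.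
apply: (@le_trans _ _ (`|a n - ratr q| * (`|w n| + 1))).
  by rewrite ler_wpM2l// lerDl.
by rewrite -ler_pdivlMr// distrC gtr0_norm ?subr_gt0// lerBlDl ltW.
Qed.

Lemma separable_span :
  (forall v (e : R), 0 < e ->
     exists n (a : nat -> R), `|v - \sum_(j < n) a j *: w j| < e) ->
  separable V.
Proof.
move=> spanw; exists (\bigcup_n rat_span n).
  by apply: bigcup_countable => // n _; exact: countable_rat_span.
move=> O [v Ov] oO.
have /nbhs_ballP[e /= e0 eO] : nbhs v O by exact: open_nbhs_nbhs.
have e2 : 0 < e / 2 by rewrite divr_gt0.
have [n [a va]] := spanw v _ e2; have [u nu au] := rat_span_approx n a e2.
exists u; split; last by exists n.
apply: eO; rewrite -ball_normE /= (splitr e).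
rewrite -(subrK (\sum_(j < n) a j *: w j) v) -addrA.
by rewrite (le_lt_trans (ler_normD _ _))// ltrD.
Qed.

End RationalSpan.

Section DualApproximation.
Context (R : realType) (U : normedModType R).
Implicit Types (f g : normed_dual U) (u v : U) (c : R).

Lemma dual_funZ f a u : f (a *: u) = a * f u.
Proof. by have := dual_fun_linear f a u 0; rewrite addr0 dual_fun0 addr0. Qed.

Lemma dual_funD f u v : f (u + v) = f u + f v.
Proof. by have := dual_fun_linear f 1 u v; rewrite !scale1r. Qed.

Lemma dual_funB f u v : f (u - v) = f u - f v.
Proof. by rewrite dual_funD -scaleN1r dual_funZ mulN1r. Qed.

Lemma continuous_functional_bounded (f : U -> R^o) :
  linear f -> (forall u, `|f u| <= `|u|) -> f \in continuous_functional (V := U).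
Proof.
move=> lf fb; apply/continuous_functionalP; split => // u.
apply/cvgrPdist_le => e e0.
have /cvgrPdist_le/(_ e e0) := @cvg_id _ (nbhs u).
apply: filterS => v uv; apply: le_trans uv.
have -> : f u - f v = f (u - v).
  by rewrite (addrC u) -[- v]scaleN1r lf scaleN1r addrC.
exact: fb.
Qed.

(* One step of the Hahn-Banach extension, phrased for [f] modulo [g]. *)
Lemma dual_approx1 (S : set U) f g c : 0 <= c -> S 0 ->
  (forall a u v, S u -> S v -> S (a *: u + v)) ->
  (forall v, S v -> g v = 0 -> `|f v| <= c * `|v|) ->
  exists a, forall v, S v -> `|f v - a * g v| <= c * `|v|.
Proof.
move=> c0 S0 SL fS.
have SZ a u : S u -> S (a *: u) by move=> Su; rewrite -[_ *: _]addr0; exact: SL.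
have [[e [Se ge]]|no] := pselect (exists v, S v /\ g v <> 0); last first.
  exists 0 => v Sv; rewrite mul0r subr0; apply: fS => //.
  by apply: contrapT => gv; apply: no; exists v.
(* By homogeneity only the vectors with [g v = 1] matter, and [a] must separate the values
   [f v - c * |v|] from the values [f v + c * |v|]; the supremum of the former does. *)
pose L := [set f v - c * `|v| | v in [set v | S v /\ g v = 1]].
have sep u v : S u -> S v -> g u = 1 -> g v = 1 ->
    f u - c * `|u| <= f v + c * `|v|.
  move=> Su Sv gu gv.
  have Suv : S (u - v) by rewrite -scaleN1r addrC; exact: SL.
  have := fS _ Suv; rewrite !dual_funB gu gv subrr => /(_ erefl).
  move=> /(le_trans (ler_norm _)).
  by have := ler_wpM2l c0 (ler_normB u v); lra.
exists (sup L) => v Sv.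
have [gv|/eqP gv] := pselect (g v = 0); first by rewrite gv mulr0 subr0; exact: fS.
have g1 : g ((g v)^-1 *: v) = 1 by rewrite dual_funZ mulVf.
have main : `|f ((g v)^-1 *: v) - sup L| <= c * `|(g v)^-1 *: v|.
  set u := _ *: v in g1 *; have Su : S u by exact: SZ.
  have Lu : L (f u - c * `|u|) by exists u.
  have Lub x : S x -> g x = 1 -> ubound L (f x + c * `|x|).
    by move=> Sx gx _ [y [Sy gy] <-]; exact: sep.
  have := sup_upper_bound (conj (ex_intro _ _ Lu) (ex_intro _ _ (Lub u Su g1))) Lu.
  have := ge_sup (ex_intro _ _ Lu) (Lub u Su g1).
  rewrite ler_norml; lra.
have -> : f v - sup L * g v = g v * (f ((g v)^-1 *: v) - sup L).
  by rewrite mulrBr dual_funZ mulrA divff// mul1r (mulrC (sup L)).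
rewrite normrM; apply: (le_trans (ler_wpM2l (normr_ge0 _) main)).
by rewrite mulrCA -normrZ scalerA divff// scale1r.
Qed.

(** The coefficient of the last functional is found first, on the common kernel of the others;
    subtracting that multiple leaves the same problem with one functional fewer. *)
Lemma dual_approx (d : nat -> normed_dual U) n f c : 0 <= c ->
  (forall v, (forall j, (j < n)%N -> d j v = 0) -> `|f v| <= c * `|v|) ->
  exists a : nat -> R, `|f - \sum_(j < n) a j *: d j| <= c.
Proof.
move=> c0; elim: n f => [|n IH] f fS.
  exists (fun=> 0); rewrite big_ord0 subr0; apply: dual_norm_le => v v1.
  by apply: (@le_trans _ _ (c * `|v|)); [exact: fS|rewrite ler_piMr].
have [||v Sv dv|a fa] :=
  @dual_approx1 [set v | forall j, (j < n)%N -> d j v = 0] f (d n) c c0.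
- by move=> j _; exact: dual_fun0.
- by move=> a u v Su Sv j jn; rewrite dual_funD dual_funZ Su// Sv// mulr0 addr0.
- by apply: fS => j; rewrite ltnS leq_eqVlt => /predU1P[->//|]; exact: Sv.
have [b fb] := IH (f - a *: d n) fa.
exists (fun j => if j == n then a else b j).
rewrite big_ord_recr /= eqxx opprD addrA addrAC.
rewrite (eq_bigr (fun j : 'I_n => b j *: d j))// => j _.
by rewrite (ltn_eqF (ltn_ord j)).
Qed.

(** A functional outside the closed span of the [d j] would, by [dual_approx], stay large on unit
    vectors of every finite common kernel; without such functionals the span is dense. *)
Lemma dual_separable (d : nat -> normed_dual U) :
  (forall f c, 0 < c ->
    (forall n, exists v,
      [/\ forall j, (j < n)%N -> d j v = 0, `|v| <= 1 & c <= f v]) -> False) ->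
  separable (normed_dual U).
Proof.
move=> nof; apply: (@separable_span _ _ d) => f e e0; apply: contrapT => no.
have e2 : 0 < e / 2 by rewrite divr_gt0.
apply: (nof f _ e2) => n; apply: contrapT => nov; apply: no; exists n.
suff [a fa] : exists a : nat -> R, `|f - \sum_(j < n) a j *: d j| <= e / 2.
  by exists a; rewrite (le_lt_trans fa)// ltr_pdivrMr// ltr_pMr// ltr1n.
apply: (dual_approx (ltW e2)) => v dv.
have small u : (forall j, (j < n)%N -> d j u = 0) -> f u <= e / 2 * `|u|.
  move=> du; have [->|u0] := eqVneq u 0; first by rewrite dual_fun0 normr0 mulr0.
  have nu : 0 < `|u| by rewrite normr_gt0.
  rewrite -ler_pdivrMr// leNgt; apply/negP => fu; apply: nov.
  exists (`|u|^-1 *: u); split.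
  - by move=> j jn; rewrite dual_funZ du// mulr0.
  - by rewrite normrZ normfV normr_id mulVf// gt_eqF.
  - by rewrite dual_funZ [leRHS]mulrC ltW.
rewrite ler_norml small// andbT lerNl -mulN1r -dual_funZ scaleN1r -(normrN v).
by apply: small => j jn; rewrite -scaleN1r dual_funZ dv// mulr0.
Qed.

End DualApproximation.

Section SubspaceOperations.
Context (R : realType) (V : normedModType R) (E : submodClosed V).

Lemma subspace_valD (u v : linear_subspace E) :
  subspace_val (u + v) = subspace_val u + subspace_val v.
Proof. by []. Qed.

Lemma subspace_valZ a (u : linear_subspace E) :
  subspace_val (a *: u) = a *: subspace_val u.
Proof. by []. Qed.

Lemma subspace_normE (u : linear_subspace E) : `|u| = `|subspace_val u|.
Proof. by []. Qed.

End SubspaceOperations.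

(** * Subspaces of the little-Lipschitz space have separable duals *)

Section LittleLipschitzAsplund.
Context (R : realType) (T : topologicalType) (w : T -> T -> {nonneg R}).
Hypothesis cT : compact [set: T].
Variable xs : nat -> option T.
Hypothesis xs_dense : forall y (e : R), 0 < e ->
  exists n x, xs n = Some x /\ (w y x)%:num <= e.
Variable E : submodClosed (little_lip w).

Let U := linear_subspace E.
Let ev (x : T) (v : U) : R^o := (subspace_val v) x.

Let evD x u v : ev x (u + v) = ev x u + ev x v :> R.
Proof. by rewrite /ev subspace_valD little_lip_funD. Qed.

Let evZ x a v : ev x (a *: v) = a * ev x v :> R.
Proof. by rewrite /ev subspace_valZ little_lip_funZ. Qed.

Let ev_norm x v : `|ev x v : R| <= `|v|.
Proof. by rewrite subspace_normE; exact: ler_little_lip. Qed.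

Let evP x : ev x \in continuous_functional (V := U).
Proof.
apply: continuous_functional_bounded => [a u v|u]; last exact: ev_norm.
by rewrite evD evZ.
Qed.

Let d j : normed_dual U := if xs j is Some x then NormedDual (evP x) else 0.

Section Functional.
Variables (f : normed_dual U) (c : R).
Hypothesis c0 : 0 < c.
Hypothesis fc : forall n, exists v,
  [/\ forall j, (j < n)%N -> d j v = 0, `|v| <= 1 & c <= f v].

(** Vectors of the unit ball that vanish at [xs n] are at most [w x y] at [x], where
    [xs n = Some y]; so the admissible vectors tend to 0 pointwise and [simons_null] applies to
    their convex sets. *)
Let uniformly_small (e : R) : 0 < e ->
  exists v : U, [/\ `|v| <= 1, c <= f v & forall x, `|ev x v| <= e].
Proof.
move=> e0.
pose C n := [set g : T -> R | exists v : U, [/\ g = fun x => ev x v,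
  forall j, (j < n)%N -> d j v = 0, `|v| <= 1 & c <= f v]].
have [||||||_ [v [-> _ v1 fv]] ve] := @simons_null R T C 1 cT _ _ _ _ _ _ e e0.
- by move=> n _ [v [-> _ _ _]]; exact: little_lip_continuous.
- by move=> n _ x [v [-> _ v1 _]]; exact: le_trans (ev_norm x v) v1.
- by move=> n; have [v [dv v1 fv]] := fc n; exists (fun x => ev x v), v.
- move=> n _ [v [-> dv v1 fv]]; exists v; split => // j jn; apply: dv.
  exact: ltnW.
- move=> n _ _ [u [-> du u1 fu]] [v [-> dv v1 fv]].
  exists (2^-1 *: (u + v)); split.
  + by apply/funext => x; rewrite evZ evD mulrC.
  + by move=> j jn; rewrite dual_funZ dual_funD du// dv// addr0 mulr0.
  + rewrite normrZ gtr0_norm ?invr_gt0// mulrC ler_pdivrMr//.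
    by rewrite (le_trans (ler_normD _ _))//; lra.
  + by rewrite dual_funZ dual_funD; lra.
- move=> x r r0; have [n [y [xn xy]]] := xs_dense x r0.
  exists n.+1 => _ [v [-> dv v1 _]].
  have vy : ev y v = 0 by have := dv n (ltnSn n); rewrite /d xn.
  have [_ /(_ x y)] := little_lip_normP (subspace_val v).
  rewrite -[little_lip_fun _ y]/(ev y v) vy subr0 => /le_trans; apply.
  by apply: le_trans xy; rewrite ler_piMl.
by exists v.
Qed.

(* A gliding hump: an element that is uniformly small on the scales where the
   previous sum has not yet become negligible adds almost nothing to the norm. *)
Let flat_sum n (e : R) : 0 < e ->
  exists v : U, `|v| <= 1 + e /\ n%:R * c <= f v.
Proof.
elim: n e => [|n IH] e e0.
  by exists 0; rewrite normr0 mul0r dual_fun0 addr_ge0// ltW.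
have e2 : 0 < e / 2 by rewrite divr_gt0.
have [v [v1 fv]] := IH _ e2.
have [t t0 vt] := little_lip_little (subspace_val v) e2.
(* The bound [e / 2] serves the sup norm; [e * t / 4], used at two points, costs [e / 2 * t] on
   pairs with [t <= w x y]. On closer pairs it is [v] that contributes only [e / 2 * w x y]. *)
have et : 0 < Num.min (e / 2) (e * t / 4) by rewrite lt_min e2 !mulr_gt0.
have [u [u1 fu ue]] := uniformly_small et.
exists (v + u); split; last first.
  by rewrite dual_funD -natr1 mulrDl mul1r lerD.
rewrite subspace_normE subspace_valD.
apply: little_lip_norm_le; first by rewrite addr_ge0// ltW.
have vn := little_lip_normP (subspace_val v).
have un := little_lip_normP (subspace_val u).
rewrite subspace_normE in v1; rewrite subspace_normE in u1.
split=> [x|x y]; rewrite !little_lip_funD.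
  rewrite (le_trans (ler_normD _ _))// (splitr e) addrA lerD//.
    exact: le_trans (vn.1 x) v1.
  by have := ue x; rewrite le_min => /andP[].
rewrite opprD addrACA (le_trans (ler_normD _ _))//.
have [wt|tw] := ltP (w x y)%:num t.
  apply: (@le_trans _ _ (e / 2 * (w x y)%:num + 1 * (w x y)%:num)).
    rewrite lerD//; first exact: vt.
    by apply: le_trans (un.2 x y) _; rewrite ler_wpM2r.
  by have : 0 <= (w x y)%:num by []; nra.
apply: (@le_trans _ _ ((1 + e / 2) * (w x y)%:num + e / 2 * t)).
  rewrite lerD//; first by apply: le_trans (vn.2 x y) _; rewrite ler_wpM2r.
  rewrite (le_trans (ler_normB _ _))//.
  by have := ue x; have := ue y; rewrite !le_min => /andP[_ ?] /andP[_ ?]; lra.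
by have : 0 <= (w x y)%:num by []; nra.
Qed.

Lemma no_hidden_functional : False.
Proof.
have [n cn] : exists n, `|f| * 2 / c < n%:R.
  exists (Num.truncn (`|f| * 2 / c)).+1.
  by case/andP: (truncn_itv (divr_ge0 (mulr_ge0 (normr_ge0 f) (ler0n R 2))
    (ltW c0))).
have [v [v1 fv]] := flat_sum n ltr01.
move: cn; rewrite ltr_pdivrMr// ltNge => /negP; apply.
rewrite (le_trans fv)// (le_trans (ler_norm _))//.
by rewrite (le_trans (dual_normP f v))// ler_wpM2l ?dual_norm_ge0.
Qed.

End Functional.

Lemma little_lip_dual_separable : separable (normed_dual U).
Proof. by apply: (@dual_separable _ _ d) => f c c0; exact: no_hidden_functional. Qed.

End LittleLipschitzAsplund.

(** * Almost equicontinuity and fragmentation *)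

Section Fragmentation.
Context (R : realType) (G : topologicalGroupType) (X : metricType R).
Variable act : G -> X -> X.
Hypothesis contact : continuous_action act.

Lemma act1 x : act 1%g x = x. Proof. by case: contact. Qed.

Lemma actM g h x : act (g * h)%g x = act g (act h x).
Proof. by case: contact => _ + _; apply. Qed.

Lemma actK g x : act g^-1%g (act g x) = x.
Proof. by rewrite -actM mulVg act1. Qed.

Lemma act_continuous g : continuous (act g).
Proof.
move=> x; case: contact => _ _ /(_ (g, x)) cact.
by apply: (cvg_comp2 (h := fun g x => act g x)) (cvg_cst g) (@cvg_id _ _) cact.
Qed.

(** Expresses [sup_g d(gx, gy) <= e] without forming the supremum. *)
Definition orbit_close (e : R) (x y : X) : Prop :=
  forall g, mdist (act g x) (act g y) <= e.

Lemma orbit_close_act e g x y :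
  orbit_close e (act g x) (act g y) -> orbit_close e x y.
Proof. by move=> xy h; have := xy (h * g^-1)%g; rewrite !actM !actK. Qed.

Lemma orbit_close_closure e (S : set X) :
  (forall x y, S x -> S y -> orbit_close e x y) ->
  forall x y, closure S x -> closure S y -> orbit_close e x y.
Proof.
move=> Se x y Sx Sy g; apply/ler_addgt0Pr => d d0.
have d2 : 0 < d / 2 by rewrite divr_gt0.
have near z : closure S z -> exists2 z', S z' & mdist (act g z) (act g z') < d / 2.
  move=> Sz; have /Sz[z' [Sz' zz']] : nbhs z (act g @^-1` ball (act g z) (d / 2)).
    by apply: act_continuous; exact: nbhsx_ballx.
  by exists z' => //; move: zz'; rewrite /= ballEmdist.
have [x' Sx' xx'] := near x Sx; have [y' Sy' yy'] := near y Sy.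
have := metric_triangle (act g x) (act g x') (act g y).
have := metric_triangle (act g x') (act g y') (act g y).
by have := Se _ _ Sx' Sy' g; move: yy'; rewrite (metric_sym (act g y)); lra.
Qed.

Definition countably_small (e : R) (S : set X) : Prop :=
  exists c : X -> nat, forall x y, S x -> S y -> c x = c y -> orbit_close e x y.

Lemma countably_small_bigcup e (F : nat -> set X) :
  (forall n, countably_small e (F n)) -> countably_small e (\bigcup_n F n).
Proof.
move=> /choice[c cF].
have /choice[k kP] : forall x, exists n, (\bigcup_n F n) x -> F n x.
  move=> x; have [[n _ Fnx]|no] := pselect ((\bigcup_n F n) x).
    by exists n.
  by exists 0%N => /no.
exists (fun x => pickle (k x, c (k x) x)) => x y Fx Fy /(pcan_inj pickleK)[kxy].
by rewrite kxy; apply: cF; [rewrite -kxy|]; exact: kP.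
Qed.

Lemma countably_smallU e S T : countably_small e S -> countably_small e T ->
  countably_small e (S `|` T).
Proof.
move=> Se Te.
have [c cP] := @countably_small_bigcup e (fun n => if n is 0%N then S else T)
  (fun n => if n is 0%N then Se else Te).
by exists c => x y Sx Sy; apply: cP; [case: Sx|case: Sy];
  by [exists 0%N|exists 1%N].
Qed.

(* [X] is separable for the pseudometric [sup_g d (g x) (g y)]. *)
Definition fragmented : Prop :=
  forall e, 0 < e -> countably_small e [set: X].

(** One point is picked from each colour class at each scale 1/(k+1); empty classes give [None]. *)
Lemma fragmented_dense : fragmented -> exists xs : nat -> option X,
  forall y e, 0 < e -> exists n x, xs n = Some x /\ orbit_close e y x.
Proof.
move=> frag.
have /choice[c cP] : forall k, exists c : X -> nat,
    forall x y, c x = c y -> orbit_close k.+1%:R^-1 x y.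
  move=> k; have [//|c cP] := frag k.+1%:R^-1.
  by exists c => x y; exact: cP.
have /choice[r rP] : forall p : nat * nat, exists o : option X,
    forall y, c p.1 y = p.2 -> exists2 x, o = Some x & c p.1 x = p.2.
  move=> [k i] /=; have [[x cx]|no] := pselect (exists x, c k x = i).
    by exists (Some x) => y _; exists x.
  by exists None => y cy; case: no; exists y.
exists (fun n => obind r (unpickle n)) => y e e0.
have [k] := @ltr_add_invr R 0 e e0; rewrite add0r => ke.
have [x rx cx] := rP (k, c k y) y erefl.
exists (pickle (k, c k y)), x; rewrite pickleK; split => // g.
by apply: (le_trans _ (ltW ke)); apply: cP.
Qed.

Section Compact.
Hypothesis compactX : compact [set: X].

Lemma hae_fragmented : hereditarily_almost_equicontinuous act -> fragmented.
Proof.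
move=> hae e e0.
(* A countable subfamily of these sets already covers their union, so [U] is the largest countably
   small open set. *)
pose I := {O : set X | open O /\ countably_small e O}.
have [J JP] := @compact_lindelof R X I sval compactX (fun i => (svalP i).1).
pose U := \bigcup_n (if J n is Some i then sval i else set0).
have Ue : countably_small e U.
  apply: countably_small_bigcup => n; case: (J n) => [i|]; first exact: (svalP i).2.
  by exists (fun=> 0%N).
have subU O : open O -> countably_small e O -> O `<=` U.
  move=> oO Oe x Ox.
  have [n [j [Jn jx]]] := JP (exist _ O (conj oO Oe)) x Ox.
  by exists n => //; rewrite Jn.
have oU : open U.
  apply: bigcup_open => n _; case: (J n) => [i|]; first exact: (svalP i).1.
  exact: open0.
have [[a Ua]|UT] := pselect (exists x, (~` U) x); last first.
  have [c cP] := Ue; exists c => x y _ _.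
  by apply: cP; apply: contrapT => Ux; apply: UT; [exists x|exists y].
have sysA : closed_subsystem act (~` U).
  split; [by exists a|exact: open_closedC|move=> g x Ux [n _]].
  case: (J n) => [i|//] Ogx; apply: Ux; case: i Ogx => O [oO [c cO]] /= Ogx.
  (* The preimage of a small open set under a translation is small for the transported colouring,
     which makes the complement of [U] invariant. *)
  apply: (subU (act g @^-1` O)) Ogx.
    by apply: open_comp => // y _; exact: act_continuous.
  exists (c \o act g) => x' y' Ox' Oy' cxy.
  by apply: (@orbit_close_act e g); exact: cO.
have [p [[Up equip] _]] := hae _ sysA a Ua _ (filterT).
exfalso; apply: Up.
have := equip (e / 2) (divr_gt0 e0 (ltr0Sn R 1)).
rewrite near_withinE => /nbhs_interior; set W := (X in nbhs _ X) => Wp.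
have oW : open W by exact: open_interior.
apply: (subU W oW _ p (nbhs_singleton Wp)).
(* By equicontinuity at [p] a single colour suffices on the part of [W] outside [U]; hence [W] is
   small and [p] would lie in [U]. *)
have [c cP] : countably_small e (U `|` (W `&` ~` U)).
  apply: countably_smallU => //; exists (fun=> 0%N) => x y [Wx Ux] [Wy Uy] _ g.
  have := interior_subset Wx Ux g; have := interior_subset Wy Uy g.
  have := metric_triangle (act g x) (act g p) (act g y).
  by rewrite (metric_sym (act g y)); lra.
have WU x : W x -> (U `|` (W `&` ~` U)) x.
  by move=> Wx; have [?|?] := pselect (U x); [left|right].
by exists c => x y /WU Wx /WU Wy; exact: cP.
Qed.

Lemma fragmented_hae : fragmented -> hereditarily_almost_equicontinuous act.
Proof.
move=> frag A [A0 clA invA] a Aa B Ba.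
have /choice[c cP] : forall k, exists c : X -> nat,
    forall x y, c x = c y -> orbit_close k.+1%:R^-1 x y.
  move=> k; have [//|c cP] := frag k.+1%:R^-1.
  by exists c => x y; exact: cP.
pose K (p : nat * nat) := closure (A `&` [set x | c p.1 x = p.2]).
(* The subtracted interior consists of the points around which [A] is contained in [K p], so [F n]
   is the boundary of [K p] relative to [A]. *)
pose F n := if unpickle n is Some p then K p `\` (~` A `|` K p)° else set0.
have [|||||p [Ap Bp Fp]] := @compact_baire X A F (B°) (@uniform_regular X).
- exact: subclosed_compact compactX _.
- rewrite /F => n; case: (unpickle n) => [i|]; last exact: closed0.
  by apply: closedI; [exact: closed_closure|apply: open_closedC; exact: open_interior].
- move=> n V oV [x [Vx Ax]]; apply: contrapT => no.
  have VF y : V y -> A y -> F n y.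
    by move=> Vy Ay; apply: contrapT => Fy; apply: no; exists y.
  have := VF x Vx Ax; move: VF; rewrite /F; case: (unpickle n) => [i|//] VF [_ nKx].
  apply: nKx; apply: (@filterS _ (nbhs x) _ V); last exact: open_nbhs_nbhs.
  move=> y Vy; have [Ay|] := pselect (A y); last by left.
  by right; have [] := VF y Vy Ay.
- exact: open_interior.
- have := Aa; exists a; split => //; exact: nbhs_singleton (nbhs_interior Ba).
exists p; split; last exact: interior_subset.
split => // e e0.
have [k] := @ltr_add_invr R 0 e e0; rewrite add0r => ke.
(* [p] lies in the closure of its own colour class but not on its relative boundary, so [A] is
   contained in that closure near [p]. *)
have Kp : K (k, c k p) p by apply: subset_closure.
have := Fp (pickle (k, c k p)); rewrite /F pickleK => nKp.
have /nbhs_interior Wp : nbhs p (~` A `|` K (k, c k p)).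
  by apply: contrapT => np; apply: nKp.
rewrite near_withinE; apply: filterS (nbhs_interior Wp) => x Wx Ax g.
have [//|Kx] := interior_subset (interior_subset Wx).
apply: le_lt_trans ke; apply: (orbit_close_closure _ Kx Kp).
by move=> y z [_ cy] [_ cz]; apply: cP; rewrite cy cz.
Qed.

End Compact.
End Fragmentation.

(** * The enveloping semigroup *)

Lemma compact_set_type (T : topologicalType) (A : set T) :
  compact A -> compact [set: set_type A].
Proof.
move=> cA F FF _.
have [p [Ap clp]] := cA (set_val @ F) _
  (filterS (fun x _ => set_valP x) filterT).
exists (exist _ p (mem_set Ap)); split => // B C FB [_ [[W oW <-] /= Wp] WC].
have [|_ [[x Bx <-] Wx]] := clp (set_val @` B) W _ (open_nbhs_nbhs (conj oW Wp)).
  by apply: (@filterS _ F) FB => x Bx; exists x.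
by exists x; split => //; apply: WC.
Qed.

Lemma ptws_eval_continuous (I : eqType) (T : topologicalType) (i : I) :
  continuous (fun f : {ptws I -> T} => f i).
Proof. exact: (@proj_continuous I (fun=> T) i). Qed.

Lemma ler_minD (R : realDomainType) (m a b c : R) :
  0 <= m -> 0 <= a -> 0 <= b -> c <= a + b ->
  Num.min m c <= Num.min m a + Num.min m b.
Proof. by case: (leP m a); case: (leP m b); case: (leP m c); lra. Qed.

Section EnvelopingSemigroup.
Context (R : realType) (G : topologicalGroupType) (X : metricType R).
Variable act : G -> X -> X.
Hypothesis compactX : compact [set: X].

Let E := set_type (enveloping_semigroup act).
Let app (p : E) (x : X) : X := (set_val p : X -> X) x.

Let app_continuous x : continuous (app ^~ x).
Proof.
move=> p; apply: (@continuous_comp _ _ _ set_val (fun f : {ptws X -> X} => f x)).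
  exact: initial_continuous.
exact: ptws_eval_continuous.
Qed.

Let compactE : compact [set: E].
Proof.
apply: compact_set_type.
apply: (@subclosed_compact _ _ [set: {ptws X -> X}]) => //.
  exact: closed_closure.
have := @tychonoff X (fun=> X) (fun=> setT) (fun=> compactX).
by congr (compact _); apply/seteqP; split.
Qed.

Let ofG (g : G) : E :=
  exist _ (act g) (mem_set (subset_closure (ex_intro2 _ _ g I erefl))).

Let orbit_close_app e x y (p : E) :
  orbit_close act e x y -> mdist (app p x) (app p y) <= e.
Proof.
move=> xy; apply/ler_addgt0Pr => d d0.
have d2 : 0 < d / 2 by rewrite divr_gt0.
have near z : nbhs (set_val p : {ptws X -> X})
    [set q : {ptws X -> X} | mdist (app p z) (q z) < d / 2].
  have := @ptws_eval_continuous X X z (set_val p) _ (nbhsx_ballx _ _ d2).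
  by rewrite ballEmdist.
have [_ [[g _ <-] [gx gy]]] := set_valP p _ (filterI (near x) (near y)).
have := metric_triangle (app p x) (act g x) (app p y).
have := metric_triangle (act g x) (act g y) (app p y).
by move: gx gy (xy g) => /=; rewrite (metric_sym (app p y)); lra.
Qed.

Lemma metrizable_fragmented : metrizable R E -> fragmented act.
Proof.
move=> [d [_ _ dD] dnbhs] e e0.
have e4 : 0 < e / 4 by rewrite divr_gt0.
have e8 : 0 < e / 8 by rewrite divr_gt0.
have nball (p : E) r : 0 < r -> nbhs p [set q | d p q < r].
  by move=> r0; apply/dnbhs; exists r.
(* Uniform continuity of [p |-> p x] on the compact space [E], with a modulus indexed by an integer
   so that it can be part of a colour. *)
have modulus x : exists n : nat, forall p q : E, d p q < n.+1%:R^-1 ->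
    mdist (app p x) (app q x) <= e / 4.
  pose P (n : nat) (p : E) := forall q : E, d p q < n.+1%:R^-1 ->
    mdist (app p x) (app q x) <= e / 4.
  have cov p : [set: E] p -> \forall p' \near p & n \near \oo, P n p'.
    move=> _; have : nbhs p [set q | mdist (app p x) (app q x) < e / 8].
      have /(_ _ (nbhsx_ballx _ _ e8)) := @app_continuous x p.
      by rewrite ballEmdist.
    move=> /dnbhs[r r0 rP].
    have r2 : 0 < r / 2 by rewrite divr_gt0.
    have [n] := @ltr_add_invr R 0 _ r2; rewrite add0r => nr.
    exists ([set p' | d p p' < r / 2], [set k | n <= k]%N).
      by split => /=; [exact: nball|exists n].
    move=> [p' k] /= [pp' nk] q p'q.
    have kn : k.+1%:R^-1 <= n.+1%:R^-1 :> R by rewrite lef_pV2 ?posrE// ler_nat.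
    have /rP /= pq : d p q < r.
      rewrite (le_lt_trans (dD p p' q))// (splitr r) ltrD//.
      exact: lt_trans p'q (le_lt_trans kn nr).
    have /rP /= {}pp' : d p p' < r by apply: lt_trans pp' _; lra.
    have := metric_triangle (app p' x) (app p x) (app q x).
    by rewrite (metric_sym (app p' x) (app p x)); lra.
  have [n _ /(_ n (leqnn n)) Pn] :=
    (compact_near_coveringP _).1 compactE _ \oo P _ cov.
  by exists n => p; exact: Pn.
have /choice[k kP] := modulus.
have /choice[net netP] : forall n : nat, exists s : seq E,
    forall p : E, [set: E] p ->
    exists2 q, q \in s & d q p < n.+1%:R^-1.
  by move=> n; apply: compact_finite_cover => // p; exact: nball.
have [loc locP] : exists l : X -> nat, forall x y, l x = l y ->
    mdist x y <= e / 2.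
  have [s sP] := compact_finite_cover compactX (fun x => nbhsx_ballx x _ e4).
  exists (fun x => find (fun y => mdist y x < e / 4) s) => x y xy.
  have near z : exists2 q, onth s (find (fun y => mdist y z < e / 4) s) = Some q &
      mdist q z < e / 4.
    have [q qs] := sP z I; rewrite ballEmdist /= => qz.
    have hz : has (fun y => mdist y z < e / 4) s by apply/hasP; exists q.
    exists (nth q s (find (fun y => mdist y z < e / 4) s)).
      by rewrite onthE (nth_map q) -?has_find.
    exact: (nth_find q hz).
  have [q qx xq] := near x; have [q' qy yq] := near y.
  move: qy; rewrite -xy qx => -[qq']; rewrite -qq' in yq.
  have := metric_triangle x q y; rewrite (metric_sym x q); lra.
(* The colour records the modulus of [p |-> p x] and the cells of its values on the net of that
   mesh. For equal colours every translation is estimated by e/4 + e/2 + e/4. *)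
exists (fun x => pickle (k x, [seq loc (app p x) | p <- net (k x)])) => x y _ _.
move=> /(pcan_inj pickleK)[kxy lxy] g.
have [p ps pg] := netP (k x) (ofG g) I.
have {}lxy : loc (app p x) = loc (app p y).
  by move: lxy; rewrite -kxy => /eq_in_map/(_ p ps).
have := locP _ _ lxy; have := kP x _ _ pg.
have := kP y p (ofG g); rewrite -kxy => /(_ pg).
have -> : act g x = app (ofG g) x by [].
have -> : act g y = app (ofG g) y by [].
have := metric_triangle (app (ofG g) x) (app p x) (app (ofG g) y).
have := metric_triangle (app p x) (app p y) (app (ofG g) y).
by rewrite (metric_sym (app (ofG g) x) (app p x)); lra.
Qed.

Lemma fragmented_metrizable : fragmented act -> metrizable R E.
Proof.
move=> /(fragmented_dense (act := act))[xs xsP].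
(* Capping the [n]-th term at 1/(n+1) leaves only finitely many terms to control at each scale, so
   that the supremum [d] is continuous for pointwise convergence. *)
pose t n (p q : E) : R :=
  Num.min n.+1%:R^-1 (if xs n is Some x then mdist (app p x) (app q x) else 0).
have t_ge0 n p q : 0 <= t n p q.
  by rewrite /t le_min invr_ge0 ler0n; case: (xs n) => //= x; exact: mdist_ge0.
pose d p q := sup [set t n p q | n in [set: nat]].
have t_sup p q : has_sup [set t n p q | n in [set: nat]].
  split; first by exists (t 0%N p q), 0%N.
  exists 1 => _ [n _ <-]; rewrite /t ge_min; apply/orP; left.
  by rewrite invf_le1// ler1n.
have t_le n p q : t n p q <= d p q.
  by apply: sup_upper_bound => //; exists n.
have d_le p q e : (forall n, t n p q <= e) -> d p q <= e.
  by move=> te; apply: ge_sup; [have [] := t_sup p q|move=> _ [n _ <-]].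
have tC n p q : t n p q = t n q p.
  by rewrite /t; case: (xs n) => // x; rewrite metric_sym.
have tD n p q r : t n p r <= t n p q + t n q r.
  have n0 : 0 < n.+1%:R^-1 :> R by [].
  rewrite /t; case: (xs n) => [x|]; last by rewrite !(min_r (ltW n0)) addr0.
  apply: ler_minD; [exact: ltW|exact: mdist_ge0|exact: mdist_ge0|].
  exact: metric_triangle.
(* Elements of [E] do not expand orbit-closeness, so closeness at a point [y] of the dense sequence
   passes to every [x] near [y]. *)
have close p x e : 0 < e -> exists2 r, 0 < r & forall q, d p q < r ->
    mdist (app p x) (app q x) < e.
  move=> e0; have e4 : 0 < e / 4 by rewrite divr_gt0.
  have [n [y [ny xy]]] := xsP x _ e4.
  exists (Num.min n.+1%:R^-1 (e / 4)) => [|q]; first by rewrite lt_min e4 andbT.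
  move=> /(le_lt_trans (t_le n p q)); rewrite /t ny lt_min => /andP[].
  rewrite {1}gt_min ltxx /= => /ltW nq; rewrite (min_r nq) => qe.
  have := orbit_close_app p xy; have := orbit_close_app q xy.
  have := metric_triangle (app p x) (app p y) (app q x).
  have := metric_triangle (app p y) (app q y) (app q x).
  by rewrite (metric_sym (app q y) (app q x)); lra.
exists d; first split.
- move=> p q; split => [pq|<-]; last first.
    apply/eqP; rewrite eq_le (le_trans (t_ge0 0%N p p) (t_le _ _ _)) andbT.
    apply: d_le => n; rewrite /t ge_min; apply/orP; right.
    by case: (xs n) => // x; rewrite mdistxx.
  apply: val_inj; apply/funext => x; apply: mdist_positivity.
  apply/eqP; rewrite eq_le mdist_ge0 andbT; apply/ler_addgt0Pr => e e0.
  have [r r0 /(_ q)] := close p x e e0.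
  by rewrite pq => /(_ r0)/ltW; rewrite add0r.
- by move=> p q; congr sup; apply/seteqP; split => _ [n _ <-]; exists n.
- by move=> p q r; apply: d_le => n; rewrite (le_trans (tD n p q r))// lerD.
move=> p A; split.
  pose F := filter_from [set r : R | 0 < r] (fun r => [set q | d p q < r]).
  have FF : Filter F.
    apply: filter_from_filter; first by exists 1 => /=.
    move=> r s r0 s0; exists (Num.min r s); first by rewrite /= lt_min r0.
    by move=> q /=; rewrite lt_min => /andP.
  move=> [_ [[W oW <-] /= Wp] WA].
  have : {ptws, (set_val : E -> {ptws X -> X}) @ F --> (set_val p : {ptws X -> X})}.
    apply/pointwise_cvgP => x B /nbhs_ballP[e /= e0 eB].
    have [r r0 rP] := close p x e e0.
    exists r => // q /rP qe; apply: eB; rewrite ballEmdist; exact: qe.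
  move=> /(_ W (open_nbhs_nbhs (conj oW Wp)))[r r0 rW].
  by exists r => // q /rW; exact: WA.
move=> [e e0 eA]; apply: (@filterS _ (nbhs p) (nbhs_filter p) _ _ eA).
have e2 : 0 < e / 2 by rewrite divr_gt0.
have [N] := @ltr_add_invr R 0 _ e2; rewrite add0r => Ne.
have : \forall q \near p, forall n : 'I_N, t n p q < e / 2.
  apply: (@filter_forall E 'I_N (fun n q => t n p q < e / 2)
    (nbhs p) (nbhs_filter p)) => n.
  rewrite /t; case: (xs n) => [x|]; last first.
    by apply: nearW => q; rewrite gt_min e2 orbT.
  have := @app_continuous x p _ (nbhsx_ballx _ _ e2).
  apply: (@filterS _ (nbhs p) (nbhs_filter p)) => q.
  by rewrite /= ballEmdist /= gt_min => ->; rewrite orbT.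
apply: (@filterS _ (nbhs p) (nbhs_filter p)) => q tq.
rewrite /= (le_lt_trans _ (_ : e / 2 < e))//; last lra.
apply: d_le => n; have [nN|Nn] := ltnP n N; first exact/ltW/(tq (Ordinal nN)).
rewrite /t ge_min; apply/orP; left; rewrite (le_trans _ (ltW Ne))//.
by rewrite lef_pV2 ?posrE// ler_nat.
Qed.

End EnvelopingSemigroup.

(** * Representations on Asplund spaces *)

Section SpanSeq.
Context (R : realType) (V : normedModType R) (w : nat -> V).

Definition span_seq : {pred V} := mem [set v : V |
  exists n (a : nat -> R), v = \sum_(j < n) a j *: w j].

Lemma span_seqP v : reflect
  (exists n (a : nat -> R), v = \sum_(j < n) a j *: w j) (v \in span_seq).
Proof. by apply: (iffP idP) => [/set_mem|?]; [|exact/mem_set]. Qed.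

Let widen n N (a : nat -> R) : (n <= N)%N ->
  \sum_(j < n) a j *: w j =
  \sum_(j < N) (if (j < n)%N then a j else 0) *: w j.
Proof.
move=> nN; rewrite (big_ord_widen N (fun j => a j *: w j))// big_mkcond.
by apply: eq_bigr => j _; case: ifP => // _; rewrite scale0r.
Qed.

Fact span_seq_submod : submod_closed span_seq.
Proof.
split; first by apply/span_seqP; exists 0%N, (fun=> 0); rewrite big_ord0.
move=> c _ _ /span_seqP[n [a ->]] /span_seqP[m [b ->]]; apply/span_seqP.
rewrite (widen a (leq_maxl n m)) (widen b (leq_maxr n m)).
exists (maxn n m), (fun j => c * (if (j < n)%N then a j else 0) +
  (if (j < m)%N then b j else 0)).
rewrite scaler_sumr -big_split; apply: eq_bigr => j _ /=.
by rewrite scalerDl scalerA.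
Qed.

HB.instance Definition _ :=
  GRing.isSubmodClosed.Build R V span_seq span_seq_submod.

Lemma mem_span_seq j : w j \in span_seq.
Proof.
apply/span_seqP; exists j.+1, (fun i => (i == j)%:R).
rewrite big_ord_recr /= eqxx scale1r big1 ?add0r// => i _.
by rewrite ltn_eqF ?scale0r.
Qed.

Lemma separable_span_seq : separable (linear_subspace span_seq).
Proof.
apply: (@separable_span _ _ (fun j => LinearSubspace (mem_span_seq j))) => v e e0.
have /span_seqP[n [a va]] : subspace_val v \in span_seq by case: v.
exists n, a; rewrite subspace_normE.
suff -> : v - \sum_(j < n) a j *: LinearSubspace (mem_span_seq j) = 0.
  by rewrite -subspace_normE normr0.
apply/eqP; rewrite subr_eq0; apply/eqP/val_inj => /=.
rewrite va (big_morph _ (@subspace_valD _ _ _) erefl).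
by apply: eq_bigr => j _; rewrite subspace_valZ.
Qed.

End SpanSeq.

Lemma weak_star_eval_continuous (R : realType) (V : normedModType R) (v : V) :
  continuous (fun f : set_type (@dual_unit_ball R V) =>
    (set_val f : normed_dual V) v : R).
Proof.
move=> f; apply: (@continuous_comp _ _ _ set_val
  (fun f : weak_star V => (f : normed_dual V) v)).
  exact: initial_continuous.
move: (set_val f) => {}f.
exact: (@continuous_comp (weak_star V) {ptws V -> R} R
  (@dual_fun R V : weak_star V -> {ptws V -> R}) (fun f => f v) f
  (@initial_continuous _ _ _ f) (@ptws_eval_continuous V R v _)).
Qed.

Lemma open_mdist_lt (R : realType) (X : metricType R) (e : R) :
  open [set p : X * X | mdist p.1 p.2 < e].
Proof.
rewrite openE => p pe; apply/nbhs_ballP.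
exists ((e - mdist p.1 p.2) / 2) => [|q]; first by rewrite /= divr_gt0 ?subr_gt0.
case; rewrite !ballEmdist /= => pq1 pq2.
have := metric_triangle q.1 p.1 q.2; have := metric_triangle p.1 p.2 q.2.
by rewrite (metric_sym q.1 p.1); lra.
Qed.

Lemma ler_dist_half (R : realType) (V : normedModType R) (x y z : V) (r : R) :
  `|x - z| < r / 2 -> `|y - z| < r / 2 -> `|x - y| <= r.
Proof.
move=> xz yz; rewrite (le_trans (ler_distD z _ _))// (distrC z).
by rewrite (splitr r) lerD// ltW.
Qed.

(** * Representability on an Asplund space implies fragmentation *)

Section RadonNikodymFragmented.
Context (R : realType) (G : topologicalGroupType) (X : metricType R).
Variable act : G -> X -> X.
Hypothesis compactX : compact [set: X].

Lemma rn_fragmented : radon_nikodym R act -> fragmented act.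
Proof.
move=> [V [h [alpha [asplundV [[_ _ alpha_cont alphaG] [_ alpha_inj _]]]]]] e e0.
pose a x : normed_dual V := set_val (alpha x).
have a_cont v : continuous (fun x => a x v : R).
  move=> x; apply: (@continuous_comp _ _ _ alpha
    (fun f => (set_val f : normed_dual V) v : R)); first exact: alpha_cont.
  exact: weak_star_eval_continuous.
have a_le x v : `|a x v : R| <= `|v|.
  have := set_valP (alpha x); rewrite /dual_unit_ball /= => ax.
  by apply: (le_trans (dual_normP (a x) v)); rewrite ler_piMl.
pose O v := [set p : X * X | 1 < `|(a p.1 v : R) - a p.2 v|].
have oO v : open (O v).
  apply: (@open_comp _ _ (fun p : X * X => `|(a p.1 v : R) - a p.2 v|)
    [set r | 1 < r]).
    move=> p _; apply: (@cvg_norm _ _ _ _ _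
      (fun p : X * X => (a p.1 v : R) - a p.2 v)).
    apply: cvgB.
      by apply: (@cvg_comp _ _ _ fst (fun x => a x v : R));
        [exact: cvg_fst|exact: a_cont].
    by apply: (@cvg_comp _ _ _ snd (fun x => a x v : R));
      [exact: cvg_snd|exact: a_cont].
  exact: open_gt.
(* By compactness of [X * X], one norm bound [n] suffices to separate, by more than 1, all pairs at
   distance at least [e]. *)
pose U n := [set p : X * X | mdist p.1 p.2 < e] `|`
  \bigcup_(v in [set v : V | `|v| <= n%:R]) O v.
have [|||p _|n Un] := @compact_nondecreasing_cover _ [set: X * X] U.
- by rewrite -setXTT; exact: compact_setX.
- by move=> n; apply: openU; [exact: open_mdist_lt|exact: bigcup_open].
- move=> n p [?|[v /= vn Ov]]; [by left|right; exists v => //=].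
  by rewrite (le_trans vn)// ler_nat.
- have [?|pe] := ltP (mdist p.1 p.2) e; first by exists 0%N; left.
  have [v pv] : exists v, (a p.1 v : R) - a p.2 v != 0.
    apply: contrapT => no; move: pe; suff -> : p.1 = p.2.
      by rewrite mdistxx leNgt e0.
    apply/alpha_inj/val_inj/val_inj/funext => v.
    apply/eqP; rewrite -subr_eq0; apply: contrapT => pv; apply: no.
    by exists v; apply/negP.
  pose c := 2 / `|(a p.1 v : R) - a p.2 v|.
  have c0 : 0 < c by rewrite divr_gt0 ?normr_gt0.
  exists (Num.truncn `|c *: v|).+1; right; exists (c *: v) => /=.
    by apply: ltW; case/andP: (truncn_itv (normr_ge0 (c *: v))).
  rewrite /O /= !dual_funZ -mulrBr normrM (gtr0_norm c0) divfK ?normr_eq0//.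
  by rewrite ltr1n.
pose K := {v : V | `|v| <= n%:R}.
have [|J JP] := @compact_lindelof R (X * X)%type K
  (fun v => O (sval v)) _ (fun v => oO _).
  by rewrite -setXTT; exact: compact_setX.
pose w j := if J j is Some v then sval v else 0.
have wn j : `|w j| <= n%:R.
  by rewrite /w; case: (J j) => [v|]; [exact: (svalP v)|rewrite normr0].
(* A vector separating [g x] from [g y] is carried by the isometry [h g^-1] to one of the same norm
   separating [x] from [y], and the [w j] detect every such pair. *)
have close x y : (forall j, `|(a x (w j) : R) - a y (w j)| <= 1) ->
    orbit_close act e x y.
  move=> xyw g; rewrite leNgt; apply/negP => gxy.
  have [|[v /= vn]] := Un (act g x, act g y) I.
    by rewrite /= ltNge (ltW gxy).
  rewrite /O /= /a !alphaG => Ov.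
  pose i : K := exist _ (iso_fun (h g)^-1%g v)
    (eq_ind_r (fun r => r <= n%:R) vn (iso_norm _ v)).
  have [k [j [Jk]]] := JP i (x, y) Ov.
  by rewrite /O /= ltNge => /negP; apply; have := xyw k; rewrite /w Jk.
pose E : submodClosed V := span_seq w.
have [D cD dD] := asplundV E (separable_span_seq w).
have resP x : (fun u : linear_subspace E => a x (subspace_val u)) \in
    continuous_functional (V := linear_subspace E).
  apply: continuous_functional_bounded => [c u v|u].
    by rewrite subspace_valD subspace_valZ dual_funD dual_funZ.
  by rewrite subspace_normE.
pose res x := NormedDual (resP x).
(* Two restrictions within [r] of the same functional differ by at most 1/(n+1), hence by at most 1
   on the [w j], whose norms are at most [n]. *)
pose r : R := (n.+1%:R)^-1 / 2.
have r0 : 0 < r by rewrite divr_gt0.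
have /choice[psi psiP] : forall x, exists f, D f /\ `|res x - f| < r.
  move=> x; have [||f [xf Df]] := dD (ball (res x) r).
  - by exists (res x); exact: ballxx.
  - exact: ball_open.
  by exists f; split => //; move: xf; rewrite -ball_normE.
have /countable_injP[iota iotaP] := cD.
exists (fun x => iota (psi x)) => x y _ _ xy.
have {}xy : psi x = psi y by
  apply: (iotaP _ _ _ _ xy); apply/mem_set; [case: (psiP x)|case: (psiP y)].
apply: close => j.
have [_ xr] := psiP x; have [_ yr] := psiP y; rewrite -xy in yr.
have rxy := ler_dist_half xr yr.
pose u : linear_subspace E := LinearSubspace (mem_span_seq w j).
have -> : (a x (w j) : R) - a y (w j) = (res x - res y) u by [].
rewrite (le_trans (dual_normP (res x - res y) u))//.
apply: (@le_trans _ _ ((n.+1%:R)^-1 * n%:R)).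
  apply: ler_pM => //; first exact: dual_norm_ge0.
  by rewrite subspace_normE; exact: wn.
by rewrite mulrC ler_pdivrMr// mul1r ler_nat.
Qed.

End RadonNikodymFragmented.

(** * Fragmentation implies representability on an Asplund space *)

Section FragmentedRadonNikodym.
Context (R : realType) (G : topologicalGroupType) (X : metricType R).
Variable act : G -> X -> X.
Hypothesis contact : continuous_action act.
Hypothesis compactX : compact [set: X].

Let bounded_diameter : exists2 B : R, 0 <= B & forall x y : X, mdist x y <= B.
Proof.
have [||| p _|n Bn] := @compact_nondecreasing_cover _ [set: X * X]
  (fun n => [set p | mdist p.1 p.2 < n%:R]).
- by rewrite -setXTT; exact: compact_setX.
- by move=> n; exact: open_mdist_lt.
- by move=> n p /= /lt_le_trans; apply; rewrite ler_nat.
- exists (Num.truncn (mdist p.1 p.2)).+1 => /=.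
  by case/andP: (truncn_itv (mdist_ge0 p.1 p.2)).
by exists n%:R => // x y; exact/ltW/(Bn (x, y)).
Qed.

Definition orbit_dist (x y : X) : R :=
  sup [set mdist (act g x) (act g y) | g in [set: G]].

Let has_sup_orbit_dist x y :
  has_sup [set mdist (act g x) (act g y) | g in [set: G]].
Proof.
split; first by exists (mdist (act 1%g x) (act 1%g y)), 1%g.
by have [B _ dB] := bounded_diameter; exists B => _ [g _ <-].
Qed.

Let le_orbit_dist g x y : mdist (act g x) (act g y) <= orbit_dist x y.
Proof. by apply: sup_upper_bound => //; exists g. Qed.

Let orbit_dist_le x y e : orbit_close act e x y -> orbit_dist x y <= e.
Proof.
by move=> xy; apply: ge_sup => [|_ [g _ <-]//]; have [] := has_sup_orbit_dist x y.
Qed.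

Let orbit_dist_act g x y : orbit_dist (act g x) (act g y) = orbit_dist x y.
Proof.
apply/eqP; rewrite eq_le; apply/andP; split; apply: orbit_dist_le => k.
  by rewrite -!(actM contact).
have := le_orbit_dist (k * g^-1)%g (act g x) (act g y).
by rewrite !(actM contact) !(actK contact).
Qed.

Let mdist_le_orbit_dist x y : mdist x y <= orbit_dist x y.
Proof. by have := le_orbit_dist 1%g x y; rewrite !(act1 contact). Qed.

Let orbit_dist_ge0 x y : 0 <= orbit_dist x y.
Proof. exact: le_trans (mdist_ge0 x y) (mdist_le_orbit_dist x y). Qed.

(* The functions below are Lipschitz for the square root of [orbit_dist], so
   that functions that are Lipschitz for [orbit_dist] become little-Lipschitz. *)
Definition orbit_weight (x y : X) : {nonneg R} :=
  NngNum (sqrtr_ge0 (orbit_dist x y)).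

Let w := orbit_weight.
Let V := little_lip w.

Let w_act g x y : w (act g x) (act g y) = w x y.
Proof. by apply: val_inj; rewrite /= orbit_dist_act. Qed.

Let w_sqr x y : (w x y)%:num * (w x y)%:num = orbit_dist x y.
Proof. by rewrite -expr2 sqr_sqrtr. Qed.

Let lip_bound_act g (f : X -> R) M :
  lip_bound w f M -> lip_bound w (f \o act g) M.
Proof.
move=> [fM fwM]; split=> [x|x y]; first exact: fM.
by rewrite -(w_act g); exact: fwM.
Qed.

Let translate_subproof g (f : V) :
  (f \o act g^-1%g : X -> R^o) \in little_lipschitz w.
Proof.
apply/little_lipschitzP; split.
- move=> x; apply: continuous_comp; first exact: act_continuous.
  exact: little_lip_continuous.
- by exists `|f|; apply: lip_bound_act; exact: little_lip_normP.
move=> e e0; have [t t0 ft] := little_lip_little f e0; exists t => // x y.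
by rewrite -(w_act g^-1%g); exact: ft.
Qed.

Let translate g (f : V) : V := LittleLip (translate_subproof g f).

Let translateE g f x : translate g f x = f (act g^-1%g x). Proof. by []. Qed.

Let little_lip_ext (f1 f2 : V) : (forall x, f1 x = f2 x) -> f1 = f2.
Proof. by move=> f12; apply/val_inj/funext. Qed.

Let translateM g k f : translate (g * k)%g f = translate g (translate k f).
Proof. by apply: little_lip_ext => x; rewrite !translateE invgM (actM contact). Qed.

Let translate1 f : translate 1%g f = f.
Proof. by apply: little_lip_ext => x; rewrite translateE invg1 (act1 contact). Qed.

Let translate_norm_le g f : `|translate g f| <= `|f|.
Proof.
apply: little_lip_norm_le => //; apply: lip_bound_act; exact: little_lip_normP.
Qed.

Let translate_iso g : linear_isometries (translate g).
Proof.
split=> [a u v|v|v].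
- by apply: little_lip_ext => x; rewrite translateE !little_lip_funD !little_lip_funZ.
- apply/eqP; rewrite eq_le translate_norm_le /=.
  rewrite -[leLHS]/(`|v|) -{1}(translate1 v) -(mulVg g) translateM.
  exact: translate_norm_le.
- by exists (translate g^-1%g v); rewrite -translateM mulgV translate1.
Qed.

Let h g : iso V := mk_iso (translate_iso g).

(** [f (g^-1 x)] is jointly continuous in [g] and [x], and compactness of [X] makes the continuity
    in [g] uniform in [x]. *)
Let translate_near (f : V) g0 (e : R) : 0 < e ->
  \forall g \near g0, forall x, `|f (act g0^-1%g x) - f (act g^-1%g x)| <= e.
Proof.
move=> e0; have e2 : 0 < e / 2 by rewrite divr_gt0.
pose F (gx : G * X) := f (act gx.1^-1%g gx.2).
have F_cont : continuous F.
  move=> gx; apply: (@continuous_comp _ _ _ (fun gx : G * X => act gx.1^-1%g gx.2) f);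
    last exact: little_lip_continuous.
  case: contact => _ _ /(_ (gx.1^-1%g, gx.2)) cact.
  apply: (cvg_comp2 (h := fun g x => act g x)) cact; last exact: cvg_snd.
  apply: (@cvg_comp _ _ _ fst (fun g : G => g^-1%g)); first exact: cvg_fst.
  exact: invg_continuous.
pose P g x := `|f (act g0^-1%g x) - f (act g^-1%g x)| <= e.
have cov x : [set: X] x -> \forall x' \near x & g \near g0, P g x'.
  move=> _; have /cvgrPdist_le/(_ _ e2) := F_cont (g0, x).
  move=> [[A B] [/= Ag0 Bx] AB]; exists (B, A) => // -[x' g] [/= Bx' Ag].
  have := AB (g0, x') (conj (nbhs_singleton Ag0) Bx').
  have := AB (g, x') (conj Ag Bx').
  rewrite /P /F /= => d1 d2.
  have -> : (f (act g0^-1%g x') : R) - f (act g^-1%g x') =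
    (f (act g0^-1%g x) - f (act g^-1%g x')) -
      (f (act g0^-1%g x) - f (act g0^-1%g x')) by lra.
  by rewrite (le_trans (ler_normB _ _))// (splitr e) lerD.
have := (compact_near_coveringP _).1 compactX _ (nbhs g0) P
  (nbhs_filter g0) cov.
by apply: (@filterS _ (nbhs g0)) => g Pg x; exact: Pg.
Qed.

(** Littleness handles pairs with [w x y < t], uniformly in [g] because [w] is invariant; on the
    other pairs uniform closeness within [e * t / 2] bounds the Lipschitz quotient by [e]. *)
Let h_continuous : continuous h.
Proof.
apply: continuous_comp_initial => g0.
apply/pointwise_cvgP => f; apply/cvgrPdist_le => e e0.
have e2 : 0 < e / 2 by rewrite divr_gt0.
have [t t0 ft] := little_lip_little f e2.
have et : 0 < Num.min e (e * t / 2) by rewrite lt_min e0 !mulr_gt0.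
apply: (@filterS _ (nbhs g0)) (translate_near f g0 et) => g gf.
apply: little_lip_norm_le; first exact: ltW.
split=> [x|x y].
  by have := gf x; rewrite le_min => /andP[].
have [wt|tw] := ltP (w x y)%:num t.
  have d0 : `|f (act g0^-1%g x) - f (act g0^-1%g y)| <= e / 2 * (w x y)%:num.
    by rewrite -(w_act g0^-1%g); apply: ft; rewrite w_act.
  have d1 : `|f (act g^-1%g x) - f (act g^-1%g y)| <= e / 2 * (w x y)%:num.
    by rewrite -(w_act g^-1%g); apply: ft; rewrite w_act.
  have -> : (translate g0 f - translate g f) x - (translate g0 f - translate g f) y =
     (f (act g0^-1%g x) - f (act g0^-1%g y)) -
     (f (act g^-1%g x) - f (act g^-1%g y)).
    rewrite -[LHS]/((f (act g0^-1%g x) - f (act g^-1%g x)) -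
      (f (act g0^-1%g y) - f (act g^-1%g y))); lra.
  by rewrite (le_trans (ler_normB _ _))//; lra.
rewrite (le_trans (ler_normB _ _))// (@le_trans _ _ (e * t))//; last first.
  by rewrite ler_pM2l.
have := gf x; have := gf y; rewrite !le_min => /andP[_ dy] /andP[_ dx].
by rewrite (le_trans (lerD dx dy))//; lra.
Qed.

Let deltaP x : (fun f : V => f x : R^o) \in continuous_functional (V := V).
Proof.
apply: continuous_functional_bounded => [a u v|u]; last exact: ler_little_lip.
by rewrite little_lip_funD little_lip_funZ.
Qed.

Let delta x : normed_dual V := NormedDual (deltaP x).

Let delta_ball x : @dual_unit_ball R V (delta x).
Proof. by apply: dual_norm_le => f f1; exact: le_trans (ler_little_lip f x) f1. Qed.

Let alpha x : set_type (@dual_unit_ball R V) :=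
  exist (fun f : weak_star V => f \in @dual_unit_ball R V) (delta x)
    (mem_set (delta_ball x)).

Let alphaE x (f : V) : (set_val (alpha x) : normed_dual V) f = f x.
Proof. by []. Qed.

Let alpha_continuous : continuous alpha.
Proof.
apply: continuous_comp_initial; apply: continuous_comp_initial => x.
by apply/pointwise_cvgP => f; exact: little_lip_continuous.
Qed.

(** The increments are at most [orbit_dist], the square of [w], so their quotient by [w] tends to 0
    at the diagonal. *)
Let dist_to_subproof x0 : (mdist x0 : X -> R^o) \in little_lipschitz w.
Proof.
have lip x y : `|mdist x0 x - mdist x0 y| <= mdist x y.
  have := metric_triangle x0 x y; have := metric_triangle x0 y x.
  by rewrite ler_norml (metric_sym y x); lra.
have lipw x y : `|mdist x0 x - mdist x0 y| <= (w x y)%:num * (w x y)%:num.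
  by rewrite w_sqr; exact: le_trans (lip x y) (mdist_le_orbit_dist x y).
have [B B0 dB] := bounded_diameter.
apply/little_lipschitzP; split.
- move=> x; apply/cvgrPdist_le => e e0; have := nbhsx_ballx x _ e0.
  by rewrite ballEmdist; apply: filterS => y /ltW; exact: le_trans.
(* [B] bounds the values and [Num.sqrt B] bounds one of the two factors [w]; the sum serves both
   estimates. *)
- exists (B + Num.sqrt B); split=> [x|x y].
    by rewrite ger0_norm ?mdist_ge0// (le_trans (dB _ _))// lerDl sqrtr_ge0.
  rewrite (le_trans (lipw x y))// ler_wpM2r//= (@le_trans _ _ (Num.sqrt B))//.
    by rewrite ler_wsqrtr//; apply: orbit_dist_le => g; exact: dB.
  by rewrite lerDr.
move=> e e0; exists e => // x y wxy.
by rewrite (le_trans (lipw x y))// ler_wpM2r// ltW.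
Qed.

Let dist_to x0 : V := LittleLip (dist_to_subproof x0).

(** Evaluation at [dist_to x] returns the distance to [x]; this separates points and exhibits each
    ball as the preimage of a weak-star open set. *)
Let alpha_embedding : topological_embedding alpha.
Proof.
split; first exact: alpha_continuous.
  move=> x y xy; apply: mdist_positivity.
  by rewrite -[LHS]/(dist_to x y) -alphaE -xy alphaE /= mdistxx.
move=> U oU.
exists (\bigcup_(p in [set p : X * R | ball p.1 p.2 `<=` U])
  [set f | (set_val f : normed_dual V) (dist_to p.1) < p.2]).
  apply: bigcup_open => -[x r] _ /=.
  apply: (@open_comp _ _ (fun f : set_type (@dual_unit_ball R V) =>
    (set_val f : normed_dual V) (dist_to x) : R) [set s | s < r]).
    by move=> f _; exact: weak_star_eval_continuous.
  exact: open_lt.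
apply/seteqP; split => [y [[x r] /= xrU]|x Ux].
  rewrite /= => xy; apply: xrU; rewrite ballEmdist; exact: xy.
have /nbhs_ballP[r /= r0 rU] : nbhs x U by exact: open_nbhs_nbhs.
by exists (x, r) => //; rewrite /= mdistxx.
Qed.

Lemma fragmented_rn : fragmented act -> radon_nikodym R act.
Proof.
move=> /(fragmented_dense (act := act))[xs xsP].
exists V, h, alpha; split.
  move=> E _; apply: (@little_lip_dual_separable _ _ w compactX xs) => y e e0.
  (* The square compensates the square root in [orbit_weight]. *)
  have [n [x [nx yx]]] := xsP y (e ^+ 2) (exprn_gt0 2 e0).
  exists n, x; split => //=.
  rewrite -(ger0_norm (ltW e0)) -sqrtr_sqr ler_wsqrtr//; exact: orbit_dist_le.
split; last exact: alpha_embedding.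
split; [exact: h_continuous| |exact: alpha_continuous|].
  by move=> g k; apply: iso_ext => f; exact: translateM.
move=> g x f.
have -> : iso_fun (h g)^-1%g f = translate g^-1%g f.
  apply: (@iso_inj _ _ (h g)); rewrite [LHS]iso_inv_funK.
  by rewrite -[RHS]/(translate g (translate g^-1%g f)) -translateM mulgV translate1.
by rewrite !alphaE translateE invgK.
Qed.

End FragmentedRadonNikodym.

(** * The equivalences, each passing through fragmentation *)

Theorem theorem1p2 (R : realType) (G : topologicalGroupType) (X : metricType R)
    (act : G -> X -> X)
    (compactX : compact [set: X]) (contact : continuous_action act) :
  (hereditarily_almost_equicontinuous act <-> radon_nikodym R act) /\
  (radon_nikodym R act <-> metrizable R (set_type (enveloping_semigroup act))).
Proof.
have hf := hae_fragmented contact compactX.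
have fh := fragmented_hae contact compactX.
have rf := rn_fragmented compactX (act := act).
have fr := fragmented_rn contact compactX.
have mf := metrizable_fragmented compactX (act := act).
have fm := fragmented_metrizable (act := act).
split; first by split=> [/hf/fr|/rf/fh].
by split=> [/rf/fm|/mf/fr].
Qed.
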